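(* Let $J\in\mathbb{C}^{q\times q}$ be a signature matrix, let $f\in\mathbb{C}^{q\times q}\langle\langle z_1,\ldots,z_N\rangle\rangle_{\rm rat}$ be a rational formal power series which is matrix-$J$-unitary on $\mathcal{T}_N$, and let $\alpha=(N;A,B,C,D;\mathbb{C}^\gamma=\bigoplus_{k=1}^N\mathbb{C}^{\gamma_k},\mathbb{C}^q)$ be a minimal GR-realization of $f$. Then $f$ is matrix-$J$-inner in $\mathcal{D}_N$ if and only if the structured Hermitian matrix $H={\rm diag}(H_1,\ldots,H_N)$ associated with $\alpha$ is strictly positive (positive definite).
   Context: Formal power series. $\mathcal{F}_N$ is the free monoid on generators $g_1,\ldots,g_N$ with empty word $\emptyset$. A formal power series (FPS) in non-commuting indeterminates $z_1,\ldots,z_N$ is $f(z)=\sum_{w\in\mathcal{F}_N}f_wz^w$, where $z^w=z_{i_1}\cdots z_{i_n}$ for $w=g_{i_1}\cdots g_{i_n}$; the indeterminates commute with coefficients and products are by convolution over factorizations of words. A scalar FPS is rational if it is obtained from non-commutative polynomials by finitely many sums, products and inversions (of FPSs with non-zero constant term); a matrix FPS is rational if all its entries are. GR-nodes. A GR-node $\alpha=(N;A,B,C,D;\mathbb{C}^r=\bigoplus_{k=1}^N\mathbb{C}^{r_k},\mathbb{C}^q)$ consists of matrices $A\in\mathbb{C}^{r\times r}$, $B\in\mathbb{C}^{r\times q}$, $C\in\mathbb{C}^{q\times r}$, $D\in\mathbb{C}^{q\times q}$, with blocks $A_{ij},B_i,C_j$ along the decomposition of $\mathbb{C}^r$. Its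 transfer function is the rational FPS $T^{\rm nc}_\alpha(z)=D+C(I_r-\Delta(z)A)^{-1}\Delta(z)B$ with $\Delta(z)={\rm diag}(z_1I_{r_1},\ldots,z_NI_{r_N})$, i.e. the coefficient at $\emptyset$ is $D$ and at $w=g_{j_1}\cdots g_{j_n}$ it is $C_{j_1}A_{j_1j_2}\cdots A_{j_{n-1}j_n}B_{j_n}$. $\alpha$ is a GR-realization of $f$ if $T_\alpha^{\rm nc}=f$; it is minimal if each $r_k$ is the smallest possible among all GR-realizations of $f$. For minimal realizations one writes $\gamma_k$ for $r_k$ and $\gamma=\sum_k\gamma_k$. Evaluation. For $Z=(Z_1,\ldots,Z_N)\in(\mathbb{C}^{n\times n})^N$, $f(Z)$ is obtained by substituting $Z_k$ for $z_k$ in a rational expression for $f$; near $Z=0$ it equals $\sum_wf_w\otimes Z^w$, and it is a $\mathbb{C}^{q\times q}\otimes\mathbb{C}^{n\times n}$-valued rational function of the entries of the $Z_k$, defined (holomorphic) on an open dense set containing a neighbourhood of $0$. Matrix-$J$-unitarity and innerness. A signature matrix is $J$ with $J=J^*=J^{-1}$. Let $\mathbb{T}^{n\times n}$ be the set of unitary $n\times n$ matrices and $\mathcal{T}_N=\coprod_{n}(\mathbb{T}^{n\times n})^N$. $f$ is matrix-$J$-unitary on $\mathcal{T}_N$ if for every $n$, $f(W)(J\otimes I_n)f(W)^*=J\otimes I_n$ at all $W\in(\mathbb{T}^{n\times n})^N$ where $f(W)$ is defined. Let $(\mathbb{D}^{n\times n})^N=\{W\in(\mathbb{C}^{n\times n})^N: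 W_kW_k^*<I_n,\ k=1,\ldots,N\}$, with closure ${\rm clos}(\mathbb{D}^{n\times n})^N=\{W: W_kW_k^*\le I_n,\ k=1,\ldots,N\}$, and $\mathcal{D}_N=\coprod_n(\mathbb{D}^{n\times n})^N$. A matrix-$J$-unitary on $\mathcal{T}_N$ rational FPS $f$ is matrix-$J$-inner in $\mathcal{D}_N$ if for every $n\in\mathbb{N}$, $f(W)(J\otimes I_n)f(W)^*\le J\otimes I_n$ at those points $W\in{\rm clos}(\mathbb{D}^{n\times n})^N$ where $f(W)$ is defined. Associated structured Hermitian matrix. If $f$ is matrix-$J$-unitary on $\mathcal{T}_N$ and $\alpha$ is a minimal GR-realization of $f$, there is a unique invertible Hermitian matrix $H={\rm diag}(H_1,\ldots,H_N)$, $H_k\in\mathbb{C}^{\gamma_k\times\gamma_k}$, with $$\begin{pmatrix}A&B\\C&D\end{pmatrix}^*\begin{pmatrix}H&0\\0&J\end{pmatrix}\begin{pmatrix}A&B\\C&D\end{pmatrix}=\begin{pmatrix}H&0\\0&J\end{pmatrix};$$ it is called the structured Hermitian matrix associated with $\alpha$. *)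

(* Defs.v *)
From HB Require Import structures.
From mathcomp Require Export all_boot all_order all_algebra.
From mathcomp Require Export reals.
From mathcomp Require Export complex.
From mathcomp Require mxtens.

Set Implicit Arguments.
Unset Strict Implicit.
Unset Printing Implicit Defensive.

Import Order.TTheory GRing.Theory Num.Theory.
Local Open Scope ring_scope.
Local Open Scope sesquilinear_scope.

(* The library's Kronecker product; [mxtens] is not imported because its
   notation for tensor powers clashes with the conjugate transpose [_ ^t*]. *)
Notation "A *t B" := (mxtens.tensmx A B)
  (at level 40, left associativity) : ring_scope.

(* In a numClosedFieldType, [0 <= z] and [0 < z] include that [z] is real, so
   both predicates below force [M] to be Hermitian. *)
Definition psdmx (C : numClosedFieldType) n (M : 'M[C]_n) : Prop :=
  forall x : 'cV[C]_n, 0 <= (x ^t* *m M *m x) 0 0.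

Definition posdefmx (C : numClosedFieldType) n (M : 'M[C]_n) : Prop :=
  forall x : 'cV[C]_n, x != 0 -> 0 < (x ^t* *m M *m x) 0 0.

Definition lemx (C : numClosedFieldType) n (P Q : 'M[C]_n) : Prop :=
  psdmx (Q - P).

Definition signature_mx (C : numClosedFieldType) q (J : 'M[C]_q) : Prop :=
  J ^t* = J /\ J *m J = 1%:M.

(* The free monoid on N generators is [seq 'I_N], with [::] as empty word. *)
Definition fps N (T : Type) := seq 'I_N -> T.

Section ScalarFPS.
Variables (C : numClosedFieldType) (N : nat).
Implicit Types f g : fps N C.

Definition fps_const (c : C) : fps N C := fun w => if w == [::] then c else 0.

Definition fps_var (k : 'I_N) : fps N C := fun w => (w == [:: k])%:R.

Definition fps_add f g : fps N C := fun w => f w + g w.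

Definition fps_mul f g : fps N C :=
  fun w => \sum_(i < (size w).+1) f (take i w) * g (drop i w).

Inductive ncexpr :=
  | ECst of C
  | EVar of 'I_N
  | EAdd of ncexpr & ncexpr
  | EMul of ncexpr & ncexpr
  | EInv of ncexpr.

(* [denotes e f]: all inversions in [e] are inversions of series with non-zero
   constant term, and [e] evaluates to [f] in the algebra of series. *)
Fixpoint denotes (e : ncexpr) f : Prop :=
  match e with
  | ECst c => f =1 fps_const c
  | EVar k => f =1 fps_var k
  | EAdd a b => exists g h, [/\ denotes a g, denotes b h & f =1 fps_add g h]
  | EMul a b => exists g h, [/\ denotes a g, denotes b h & f =1 fps_mul g h]
  | EInv a => exists g, [/\ denotes a g, g [::] != 0,
                fps_mul g f =1 fps_const 1 & fps_mul f g =1 fps_const 1]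
  end.

Variables (n : nat) (Z : 'I_N -> 'M[C]_n).

(* Meaningful only when [regular e] holds. *)
Fixpoint eval (e : ncexpr) : 'M[C]_n :=
  match e with
  | ECst c => c%:M
  | EVar k => Z k
  | EAdd a b => eval a + eval b
  | EMul a b => eval a *m eval b
  | EInv a => invmx (eval a)
  end.

Fixpoint regular (e : ncexpr) : bool :=
  match e with
  | ECst _ | EVar _ => true
  | EAdd a b | EMul a b => regular a && regular b
  | EInv a => regular a && (eval a \in unitmx)
  end.

End ScalarFPS.

Section MatrixFPS.
Variables (C : numClosedFieldType) (N q : nat).
Implicit Types f : fps N 'M[C]_q.

Definition mx_denotes (E : 'I_q -> 'I_q -> ncexpr C N) f : Prop :=
  forall i j, denotes (E i j) (fun w => f w i j).

Definition rational f : Prop := exists E, mx_denotes E f.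

(* [has_value f Z V]: f(Z) is defined and equal to V, i.e. some rational
   expression for f is regular at Z and takes the value V, the entry (i, j) of
   f contributing e_ij (x) f_ij(Z). *)
Definition has_value f n (Z : 'I_N -> 'M[C]_n) (V : 'M[C]_(q * n)) : Prop :=
  exists E, [/\ mx_denotes E f,
    forall i j, regular Z (E i j) &
    V = \sum_i \sum_j (delta_mx i j : 'M[C]_q) *t eval Z (E i j)].

Definition matrix_J_unitary (J : 'M[C]_q) f : Prop :=
  forall n (W : 'I_N -> 'M[C]_n) (V : 'M[C]_(q * n)),
    (forall k, W k \is unitarymx) -> has_value f W V ->
    V *m (J *t 1%:M) *m V ^t* = J *t 1%:M.

Definition matrix_J_inner (J : 'M[C]_q) f : Prop :=
  matrix_J_unitary J f /\
  forall n (W : 'I_N -> 'M[C]_n) (V : 'M[C]_(q * n)),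
    (forall k, lemx (W k *m (W k) ^t*) 1%:M) -> has_value f W V ->
    lemx (V *m (J *t 1%:M) *m V ^t*) (J *t 1%:M).

End MatrixFPS.

Section GRNodes.
Variables (C : numClosedFieldType) (N q : nat).

Record GRnode := {
  gr_dim : 'I_N -> nat;
  gr_A : 'M[C]_(\sum_k gr_dim k);
  gr_B : 'M[C]_(\sum_k gr_dim k, q);
  gr_C : 'M[C]_(q, \sum_k gr_dim k);
  gr_D : 'M[C]_q }.

Variable a : GRnode.

(* A_{j j_2} A_{j_2 j_3} ... A_{j_{n-1} j_n} B_{j_n} for w = g_{j_2}...g_{j_n} *)
Fixpoint gr_AB (j : 'I_N) (w : seq 'I_N) : 'M[C]_(gr_dim a j, q) :=
  match w with
  | [::] => submxcol (gr_B a) j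
  | k :: w' => submxblock (gr_A a) j k *m gr_AB k w'
  end.

Definition transfer : fps N 'M[C]_q := fun w =>
  match w with
  | [::] => gr_D a
  | j :: w' => submxrow (gr_C a) j *m gr_AB j w'
  end.

Definition GR_realization (f : fps N 'M[C]_q) : Prop := transfer =1 f.

End GRNodes.

Definition minimal_GR_realization (C : numClosedFieldType) N q
    (a : GRnode C N q) (f : fps N 'M[C]_q) : Prop :=
  GR_realization a f /\
  forall b : GRnode C N q, GR_realization b f ->
    forall k, (gr_dim a k <= gr_dim b k)%N.

Definition associated_hermitian (C : numClosedFieldType) N q (J : 'M[C]_q)
    (a : GRnode C N q) (H : forall k, 'M[C]_(gr_dim a k)) : Prop :=
  let U := block_mx (gr_A a) (gr_B a) (gr_C a) (gr_D a) in
  let HJ := block_mx (\mxdiag_k H k) 0 0 J in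
  [/\ \mxdiag_k H k \in unitmx,
      (\mxdiag_k H k) ^t* = \mxdiag_k H k &
      U ^t* *m HJ *m U = HJ].

(* Main.v *)
Require Import Defs.
From mathcomp Require Import mxtens fingroup perm ring.
Import Order.TTheory GRing.Theory Num.Theory.
Set Implicit Arguments.
Unset Strict Implicit.
Unset Printing Implicit Defensive.
Local Open Scope ring_scope.
Local Open Scope sesquilinear_scope.

(** Let E_k be the projection of C^r onto its k-th block, so that
    Delta(Z) = sum_k E_k (x) Z_k, and put K = H^-1 and
    Psi(Z) = C (I - Delta(Z) A)^-1. Since the colligation is (H, J)-unitary,
      J - f(Z) J f(Z)^* = Psi(Z) (sum_k E_k K (x) (I - Z_k Z_k^* )) Psi(Z)^*
    wherever both sides make sense. If H > 0 the right-hand side is positive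
    for contractive Z. The values of f that are given by rational expressions
    are compared with the realization along the lines t Z, where both are
    quotients of polynomials in t with the same power series at 0; points where
    the resolvent is singular are reached by letting t tend to 1.

    Conversely, let Z_k be a permutation of the words of length <= L that sends
    w to g_k w whenever |w| < L, but for one index k0 annihilate the component
    of the range along the empty word. Then I - Z_k Z_k^* vanishes for k <> k0
    and is the projection onto the empty word for k = k0, also for t Z with
    |t| = 1. By minimality the pair (C, A) is observable on the block k0, so
    for all but finitely many t the map Psi(t Z) restricted to
    (block k0) (x) (empty word) is injective, and the inequality at t Z yields
    E_k0 K >= 0. *)

(** * Rational expressions along a line *)

Section Congruence.
Variable (C : comNzRingType).

(** Power series in t enter only through truncations, compared modulo ['X^m] inside polynomial
    matrices. *)
Definition eqXmod m p q (A B : 'M[{poly C}]_(p, q)) : Prop :=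
  exists Q, A = B + 'X^m *: Q.

Lemma eqXmod_refl m p q (A : 'M_(p, q)) : eqXmod m A A.
Proof. by exists 0; rewrite scaler0 addr0. Qed.

Lemma eqXmod_sym m p q (A B : 'M_(p, q)) : eqXmod m A B -> eqXmod m B A.
Proof. by case=> Q ->; exists (- Q); rewrite scalerN addrK. Qed.

Lemma eqXmod_trans m p q (B A D : 'M_(p, q)) :
  eqXmod m A B -> eqXmod m B D -> eqXmod m A D.
Proof.
by case=> Q -> [Q' ->]; exists (Q' + Q); rewrite scalerDr addrA.
Qed.

Lemma eqXmodD m p q (A B A' B' : 'M_(p, q)) :
  eqXmod m A B -> eqXmod m A' B' -> eqXmod m (A + A') (B + B').
Proof.
by case=> Q -> [Q' ->]; exists (Q + Q'); rewrite scalerDr addrACA.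
Qed.

Lemma eqXmodZ m p q c (A B : 'M_(p, q)) :
  eqXmod m A B -> eqXmod m (c *: A) (c *: B).
Proof.
by case=> Q ->; exists (c *: Q); rewrite scalerDr !scalerA mulrC.
Qed.

Lemma eqXmod_mull m p q r (D : 'M_(p, q)) (A B : 'M_(q, r)) :
  eqXmod m A B -> eqXmod m (D *m A) (D *m B).
Proof.
by case=> Q ->; exists (D *m Q); rewrite mulmxDr -scalemxAr.
Qed.

Lemma eqXmod_mulr m p q r (D : 'M_(q, r)) (A B : 'M_(p, q)) :
  eqXmod m A B -> eqXmod m (A *m D) (B *m D).
Proof.
by case=> Q ->; exists (Q *m D); rewrite mulmxDl -scalemxAl.
Qed.

Lemma eqXmod_mulX m p q (A B : 'M_(p, q)) :
  eqXmod m A B -> eqXmod m.+1 ('X *: A) ('X *: B).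
Proof.
by case=> Q ->; exists Q; rewrite scalerDr scalerA exprS.
Qed.

Lemma eqXmod_sum m p q (I : finType) (A B : I -> 'M_(p, q)) :
  (forall i, eqXmod m (A i) (B i)) ->
  eqXmod m (\sum_i A i) (\sum_i B i).
Proof.
move=> AB; elim/big_ind2: _ => //; first exact: eqXmod_refl.
by move=> A1 B1 A2 B2; apply: eqXmodD.
Qed.

Lemma eqXmod0 p q (A B : 'M_(p, q)) : eqXmod 0 A B.
Proof. by exists (A - B); rewrite scale1r addrC subrK. Qed.

Lemma eqXmod_tens m p q r s (D : 'M_(p, q)) (A B : 'M_(r, s)) :
  eqXmod m A B -> eqXmod m (D *t A) (D *t B).
Proof.
case=> Q ->; exists (D *t Q); apply/matrixP=> i j; rewrite !mxE.
by rewrite mulrDr mulrCA.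
Qed.

Lemma eqXmod_horner0 p q (A B : 'M_(p, q)) :
  eqXmod 1 A B -> map_mx (horner_eval 0) A = map_mx (horner_eval 0) B.
Proof.
case=> Q ->; apply/matrixP=> i j; rewrite !mxE /horner_eval.
by rewrite hornerD hornerM hornerX mul0r addr0.
Qed.

(** Turns agreement of all truncations into an identity of polynomials: the coefficient of degree k
    is settled by the modulus k + 1. *)
Lemma eqXmod_eq p q (A B : 'M_(p, q)) : (forall m, eqXmod m A B) -> A = B.
Proof.
move=> AB; apply/matrixP=> i j; apply/polyP=> k.
have [Q ->] := AB k.+1; rewrite !mxE coefD coefXnM ltnS leqnn addr0.
by [].
Qed.

End Congruence.

Section Series.
Variables (C : numClosedFieldType) (N n : nat) (Z : 'I_N -> 'M[C]_n).

Local Notation liftC := (map_mx (@polyC C)).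
Local Notation ev t := (map_mx (horner_eval t)).

(* The part of degree < m in t of the series g(t Z). *)
Fixpoint ser m (g : fps N C) : 'M[{poly C}]_n :=
  if m is m'.+1 then
    (g [::])%:P%:M
    + 'X *: \sum_k liftC (Z k) *m ser m' (fun w => g (k :: w))
  else 0.

Lemma eq_ser m g h : g =1 h -> ser m g = ser m h.
Proof.
elim: m g h => //= m IHm g h gh; rewrite gh; congr (_ + _ *: _).
by apply: eq_bigr => k _; rewrite (IHm _ (fun w => h (k :: w))).
Qed.

Lemma ser_eq0 m g : g =1 (fun=> 0) -> ser m g = 0.
Proof.
elim: m g => //= m IHm g g0; rewrite g0 raddf0 add0r big1 ?scaler0 // => k _.
by rewrite IHm ?mulmx0.
Qed.

(** The combination c g + h is the shape that [fps_mul_cons] gives to the tails of a product. *)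
Lemma serZD m c g h :
  ser m (fun w => c * g w + h w) = c%:P *: ser m g + ser m h.
Proof.
elim: m g h => [|m IHm] g h /=; first by rewrite scaler0 addr0.
rewrite scalerDr addrACA; congr (_ + _).
  by rewrite polyCD polyCM raddfD /= -scale_scalar_mx.
rewrite scalerA mulrC -scalerA -scalerDr; congr (_ *: _).
rewrite scaler_sumr -big_split; apply: eq_bigr => k _.
by rewrite (IHm (fun w => g (k :: w))) mulmxDr -scalemxAr.
Qed.

Lemma serD m g h : ser m (fps_add g h) = ser m g + ser m h.
Proof.
rewrite -[ser m g]scale1r -[1](polyC1) -serZD; apply: eq_ser => w.
by rewrite /fps_add mul1r.
Qed.

Lemma serS m g : eqXmod m (ser m.+1 g) (ser m g).
Proof.
elim: m g => [|m IHm] g; first exact: eqXmod0.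
rewrite [in X in eqXmod _ _ X]/= [ser _ _]/=.
apply: eqXmodD; first exact: eqXmod_refl.
by apply/eqXmod_mulX/eqXmod_sum=> k; apply/eqXmod_mull/IHm.
Qed.

(** Leibniz rule for left derivatives: the left factor of k :: w is either empty or begins with
    k. *)
Lemma fps_mul_cons (g h : fps N C) k w :
  fps_mul g h (k :: w) =
  g [::] * h (k :: w) + fps_mul (fun v => g (k :: v)) h w.
Proof.
rewrite /fps_mul big_ord_recl /=; congr (_ + _).
Qed.

Lemma serM m g h : eqXmod m (ser m (fps_mul g h)) (ser m g *m ser m h).
Proof.
elim: m g h => [|m IHm] g h; first exact: eqXmod0.
rewrite [ser _ (fps_mul _ _)]/= [ser m.+1 g]/=.
rewrite mulmxDl mul_scalar_mx [X in eqXmod _ _ (_ *: X + _)]/=.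
rewrite scalerDr -addrA; apply: eqXmodD.
  rewrite /fps_mul big_ord1 /= polyCM scale_scalar_mx.
  exact: eqXmod_refl.
rewrite scalerA mulrC -scalerA -scalemxAl -scalerDr; apply: eqXmod_mulX.
rewrite scaler_sumr mulmx_suml. rewrite -big_split; apply: eqXmod_sum => k.
rewrite (eq_ser _ (fps_mul_cons g h k)) serZD mulmxDr -scalemxAr.
apply: eqXmodD; first exact: eqXmod_refl.
rewrite -mulmxA; apply/eqXmod_mull; apply: eqXmod_trans (IHm _ _) _.
(* The induction hypothesis supplies h truncated at m, while the product has it truncated at m +
   1. *)
by apply/eqXmod_mull/eqXmod_sym/serS.
Qed.

Lemma ser_const m c : eqXmod m (ser m (fps_const c)) c%:P%:M.
Proof.
case: m => [|m]; first exact: eqXmod0.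
rewrite /= big1 ?scaler0 ?addr0; first exact: eqXmod_refl.
by move=> k _; rewrite ser_eq0 ?mulmx0.
Qed.

Lemma ser_var m k : eqXmod m (ser m (fps_var C k)) ('X *: liftC (Z k)).
Proof.
case: m => [|m]; first exact: eqXmod0.
rewrite /= /fps_var raddf0 add0r; apply: eqXmod_mulX.
rewrite (bigD1 k) //= big1 => [|j jk]; last first.
  by rewrite ser_eq0 ?mulmx0 // => w; rewrite eqseq_cons (negPf jk).
rewrite addr0 -[X in eqXmod _ _ X]mulmx1; apply: eqXmod_mull.
apply: eqXmod_trans _ (ser_const m 1).
rewrite (@eq_ser _ _ (fps_const 1)); first exact: eqXmod_refl.
by move=> w; rewrite /fps_const eqseq_cons eqxx /=; case: eqP.
Qed.

Lemma ev_unit t (P : 'M[{poly C}]_n) :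
  (ev t P \in unitmx) = ((\det P).[t] != 0).
Proof. by rewrite unitmxE unitfE det_map_mx. Qed.

(** Induction on e: sums and products multiply the denominators, and an inverse is formed with the
    adjugate. Throughout, d records exactly the t at which some inversion in e fails. *)
Lemma expr_fraction (e : ncexpr C N) g : denotes e g ->
  exists P d, [/\ d.[0] != 0,
    forall m, eqXmod m P (d *: ser m g),
    forall t, regular (fun k => t *: Z k) e = (d.[t] != 0) &
    forall t, d.[t] != 0 ->
      d.[t] *: eval (fun k => t *: Z k) e = ev t P].
Proof.
elim: e g => [c|k|a IHa b IHb|a IHa b IHb|a IHa] g /=.
- move=> gE; exists c%:P%:M, 1; split.
  + by rewrite hornerC oner_eq0.
  + move=> m; rewrite scale1r (eq_ser _ gE).
    exact/eqXmod_sym/ser_const.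
  + by move=> t; rewrite hornerC oner_eq0.
  + move=> t _; rewrite hornerC scale1r map_scalar_mx.
    by rewrite /= /horner_eval hornerC.
- move=> gE; exists ('X *: liftC (Z k)), 1; split.
  + by rewrite hornerC oner_eq0.
  + move=> m; rewrite scale1r (eq_ser _ gE).
    exact/eqXmod_sym/ser_var.
  + by move=> t; rewrite hornerC oner_eq0.
  + move=> t _; rewrite hornerC scale1r.
    by apply/matrixP=> i j; rewrite !mxE /horner_eval hornerM hornerX hornerC.
- case=> g1 [g2 [/IHa [P1 [d1 [d10 s1 r1 v1]]] /IHb [P2 [d2 [d20 s2 r2 v2]]]]].
  move=> gE; exists (d2 *: P1 + d1 *: P2), (d1 * d2); split.
  + by rewrite hornerM mulf_neq0.
  + move=> m; rewrite (eq_ser _ gE) serD scalerDr; apply: eqXmodD.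
      by rewrite mulrC -scalerA; apply: eqXmodZ.
    by rewrite -scalerA; apply: eqXmodZ.
  + by move=> t; rewrite r1 r2 hornerM mulf_eq0 negb_or.
  + move=> t; rewrite hornerM mulf_eq0 negb_or => /andP[d1t d2t].
    rewrite scalerDr {1}[_ * _]mulrC -!scalerA v1 // v2 //.
    by apply/matrixP=> i j; rewrite !mxE /horner_eval !hornerE.
- case=> g1 [g2 [/IHa [P1 [d1 [d10 s1 r1 v1]]] /IHb [P2 [d2 [d20 s2 r2 v2]]]]].
  move=> gE; exists (P1 *m P2), (d1 * d2); split.
  + by rewrite hornerM mulf_neq0.
  + move=> m; rewrite (eq_ser _ gE).
    apply: eqXmod_trans (eqXmodZ _ (eqXmod_sym (serM _ _ _))).
    rewrite -scalerA scalemxAr scalemxAl.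
    exact: eqXmod_trans (eqXmod_mulr _ (s1 m)) (eqXmod_mull _ (s2 m)).
  + by move=> t; rewrite r1 r2 hornerM mulf_eq0 negb_or.
  + move=> t; rewrite hornerM mulf_eq0 negb_or => /andP[d1t d2t].
    by rewrite map_mxM /= -v1 // -v2 // -scalemxAl -scalemxAr scalerA.
case=> g1 [/IHa [P [d [d0 s r v]]] g10 g1g _].
(* Modulo X, P is d times the constant term of g1, a scalar matrix that is non-zero at 0. *)
have detP0 : (\det P).[0] != 0.
  rewrite -ev_unit (eqXmod_horner0 (s 1%N)) unitmxE /= big1; last first.
    by move=> k _; rewrite mulmx0.
  rewrite scaler0 addr0 scale_scalar_mx map_scalar_mx det_scalar.
  by rewrite /= /horner_eval !hornerE unitfE expf_neq0 ?mulf_neq0.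
have vP t : d.[t] != 0 ->
    (eval (fun k => t *: Z k) a \in unitmx) = ((\det P).[t] != 0).
  by move=> dt; rewrite -ev_unit -v // unitmxZ ?unitfE.
(* If a has value P / d, its inverse is d adj P / det P. The fraction is expanded by d so that the
   denominator also vanishes where a itself is not regular. *)
exists (d ^+ 2 *: \adj P), (d * \det P); split.
- by rewrite hornerM mulf_neq0.
- move=> m; rewrite expr2 -!scalerA; apply: eqXmodZ.
  have Pg : eqXmod m (P *m ser m g) (d *: 1%:M).
    apply: eqXmod_trans (eqXmod_mulr _ (s m)) _; rewrite -scalemxAl.
    apply: eqXmodZ; apply: eqXmod_trans (eqXmod_sym (serM m g1 g)) _.
    by rewrite (eq_ser _ g1g); apply: ser_const.
  rewrite -mul_scalar_mx -[X in eqXmod _ _ X]mul_scalar_mx -mul_adj_mx.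
  rewrite -mulmxA; apply: eqXmod_sym.
  apply: eqXmod_trans (eqXmod_mull _ Pg) _.
  by rewrite -scalemxAr mulmx1 mul_scalar_mx; apply: eqXmod_refl.
- move=> t; rewrite r hornerM mulf_eq0 negb_or.
  by case: eqP => //= /eqP dt; rewrite vP.
- move=> t; rewrite hornerM mulf_eq0 negb_or => /andP[dt Pt].
  have adjP : \adj (ev t P) = (\det P).[t] *: invmx (ev t P).
    rewrite /invmx ev_unit Pt det_map_mx scalerA mulfV ?scale1r //.
  rewrite map_mxZ map_mx_adj /= adjP -v // invmxZ ?unitmxZ ?unitfE ?vP //.
  by rewrite !scalerA /horner_eval horner_exp mulrAC expr2 mulfK.
Qed.
End Series.

(** * Realizations along a line *)

Section Tensor.
Variable (K : comNzRingType).

Lemma tensmxDl p q r s (A B : 'M[K]_(p, q)) (D : 'M[K]_(r, s)) :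
  (A + B) *t D = A *t D + B *t D.
Proof. by apply/matrixP=> i j; rewrite !mxE mulrDl. Qed.

Lemma tensmxDr p q r s (D : 'M[K]_(p, q)) (A B : 'M[K]_(r, s)) :
  D *t (A + B) = D *t A + D *t B.
Proof. by apply/matrixP=> i j; rewrite !mxE mulrDr. Qed.

Lemma tensmxZl p q r s c (A : 'M[K]_(p, q)) (D : 'M[K]_(r, s)) :
  (c *: A) *t D = c *: (A *t D).
Proof. by apply/matrixP=> i j; rewrite !mxE mulrA. Qed.

Lemma tensmxZr p q r s c (A : 'M[K]_(p, q)) (D : 'M[K]_(r, s)) :
  A *t (c *: D) = c *: (A *t D).
Proof. by apply/matrixP=> i j; rewrite !mxE mulrCA. Qed.

Lemma tensmxBr p q r s (D : 'M[K]_(p, q)) (A B : 'M[K]_(r, s)) :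
  D *t (A - B) = D *t A - D *t B.
Proof. by apply/matrixP=> i j; rewrite !mxE mulrBr. Qed.

Lemma tensmx_suml p q r s (I : finType) (A : I -> 'M[K]_(p, q))
    (D : 'M[K]_(r, s)) : (\sum_i A i) *t D = \sum_i (A i *t D).
Proof.
by elim/big_rec2: _ => [|i x y _ <-]; rewrite ?tens0mx // tensmxDl.
Qed.

Lemma tensmx_sumr p q r s (I : finType) (A : I -> 'M[K]_(p, q))
    (D : 'M[K]_(r, s)) : D *t (\sum_i A i) = \sum_i (D *t A i).
Proof.
by elim/big_rec2: _ => [|i x y _ <-]; rewrite ?tensmx0 // tensmxDr.
Qed.

End Tensor.

Section MatrixSeries.
Variables (C : numClosedFieldType) (N n : nat) (Z : 'I_N -> 'M[C]_n).

Local Notation liftC := (map_mx (@polyC C)).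
Local Notation ev t := (map_mx (horner_eval t)).

(** The truncation of sum_w f_w (x) (t Z)^w, with the coefficients as first tensor factor. *)
Fixpoint mser m p q (f : fps N 'M[C]_(p, q)) : 'M[{poly C}]_(p * n, q * n) :=
  if m is m'.+1 then
    liftC (f [::]) *t 1%:M
    + 'X *: \sum_k (1%:M *t liftC (Z k)) *m mser m' (fun w => f (k :: w))
  else 0.

Lemma eq_mser m p q (f g : fps N 'M[C]_(p, q)) :
  f =1 g -> mser m f = mser m g.
Proof.
elim: m f g => //= m IHm f g fg; rewrite fg; congr (_ + _ *: _).
by apply: eq_bigr => k _; rewrite (IHm _ (fun w => g (k :: w))).
Qed.

Lemma mserS m p q (f : fps N 'M[C]_(p, q)) :
  eqXmod m (mser m.+1 f) (mser m f).
Proof.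
elim: m f => [|m IHm] f; first exact: eqXmod0.
rewrite [in X in eqXmod _ _ X]/= [mser _ _]/=.
apply: eqXmodD; first exact: eqXmod_refl.
by apply/eqXmod_mulX/eqXmod_sum=> k; apply/eqXmod_mull/IHm.
Qed.

Lemma mser_mull m p q r (M : 'M_(p, q)) (f : fps N 'M[C]_(q, r)) :
  mser m (fun w => M *m f w) = (liftC M *t 1%:M) *m mser m f.
Proof.
elim: m f => [|m IHm] f /=; first by rewrite mulmx0.
rewrite mulmxDr map_mxM tensmx_mul mulmx1 -scalemxAr mulmx_sumr.
congr (_ + _ *: _); apply: eq_bigr => k _.
by rewrite (IHm (fun w => f (k :: w))) !mulmxA !tensmx_mul !mulmx1 !mul1mx.
Qed.

Lemma mser_delta m p q (f : fps N 'M[C]_(p, q)) :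
  mser m f =
  \sum_(ij : 'I_p * 'I_q)
    delta_mx ij.1 ij.2 *t ser Z m (fun w => f w ij.1 ij.2).
Proof.
elim: m f => [|m IHm] f /=.
  by rewrite big1 // => ij _; rewrite tensmx0.
under [RHS]eq_bigr do rewrite tensmxDr.
rewrite big_split; congr (_ + _).
  rewrite {1}[liftC _]matrix_sum_delta pair_bigA tensmx_suml.
  apply: eq_bigr => ij _; rewrite tensmxZl mxE.
  by rewrite -tensmxZr scale_scalar_mx mulr1.
under [RHS]eq_bigr do rewrite tensmxZr.
rewrite -scaler_sumr; congr (_ *: _).
under [RHS]eq_bigr do rewrite tensmx_sumr.
rewrite exchange_big; apply: eq_bigr => k _ /=.
rewrite IHm mulmx_sumr; apply: eq_bigr => ij _.
by rewrite tensmx_mul mul1mx.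
Qed.

Lemma mx_expr_fraction q (E : 'I_q -> 'I_q -> ncexpr C N) f :
  mx_denotes E f ->
  exists P d, [/\ d.[0] != 0,
    forall m, eqXmod m P (d *: mser m f),
    forall t, (forall i j, regular (fun k => t *: Z k) (E i j)) <->
              d.[t] != 0 &
    forall t, d.[t] != 0 ->
      d.[t] *: (\sum_i \sum_j (delta_mx i j : 'M[C]_q)
                  *t eval (fun k => t *: Z k) (E i j)) = ev t P].
Proof.
move=> Ef.
have /fin_all_exists [Pd HPd] (ij : 'I_q * 'I_q) : exists Pd, [/\ Pd.2.[0] != 0,
    forall m, eqXmod m Pd.1 (Pd.2 *: ser Z m (fun w => f w ij.1 ij.2)),
    forall t, regular (fun k => t *: Z k) (E ij.1 ij.2) = (Pd.2.[t] != 0) &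
    forall t, Pd.2.[t] != 0 ->
      Pd.2.[t] *: eval (fun k => t *: Z k) (E ij.1 ij.2) = ev t Pd.1].
  have [P [d H]] := expr_fraction Z (Ef ij.1 ij.2).
  by exists (P, d).
(* The factor that brings the entry ij to the common denominator d. *)
pose c ij := \prod_(kl | kl != ij) (Pd kl).2.
pose d := \prod_ij (Pd ij).2.
have dE ij : d = c ij * (Pd ij).2 by rewrite /d (bigD1 ij) //= mulrC.
have d_neq0 t : reflect (forall ij, (Pd ij).2.[t] != 0) (d.[t] != 0).
  rewrite /d horner_prod prodf_seq_neq0.
  apply: (iffP allP) => [H ij|H ij _]; last exact: H.
  by have := H ij; rewrite mem_index_enum; apply.
exists (\sum_ij delta_mx ij.1 ij.2 *t (c ij *: (Pd ij).1)), d; split.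
- by apply/d_neq0=> ij; case: (HPd ij).
- move=> m; rewrite mser_delta scaler_sumr; apply: eqXmod_sum => ij.
  rewrite -tensmxZr (dE ij) -scalerA; apply/eqXmod_tens/eqXmodZ.
  by case: (HPd ij).
- move=> t; split=> [reg|/d_neq0 dt i j].
    by apply/d_neq0=> ij; case: (HPd ij) => _ _ <-.
  by case: (HPd (i, j)) => _ _ -> _; apply: dt.
move=> t dt; rewrite pair_bigA scaler_sumr raddf_sum.
apply: eq_bigr => ij _ /=; rewrite map_mxT map_mxZ map_delta_mx.
case: (HPd ij) => _ _ _ <-; last by move/d_neq0: dt.
by rewrite (dE ij) hornerM -scalerA -tensmxZr -[in LHS]tensmxZr.
Qed.

End MatrixSeries.

Section Realization.
Variables (C : numClosedFieldType) (N n r q : nat) (Z : 'I_N -> 'M[C]_n).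
Variables (E : 'I_N -> 'M[C]_r).
Variables (A : 'M[C]_r) (B : 'M[C]_(r, q)) (G : 'M[C]_(q, r)) (D : 'M[C]_q).

Local Notation liftC := (map_mx (@polyC C)).
Local Notation ev t := (map_mx (horner_eval t)).
Local Notation "M ^~1" := (M *t (1%:M : 'M[C]_n)) (at level 8).

(** Full matrices with the E k in between replace the blocks of [gr_AB], whose dimensions depend on
    the letter. *)
Fixpoint words_AB (w : seq 'I_N) : 'M[C]_(r, q) :=
  if w is k :: w' then A *m E k *m words_AB w' else B.

Definition global_transfer : fps N 'M[C]_q := fun w =>
  if w is k :: w' then G *m E k *m words_AB w' else D.

(* For E the projections onto the blocks this is the matrix Delta(Z) of the
   paper, with the tensor factors in the order C^r (x) C^n. *)
Definition Delta : 'M[C]_(r * n) := \sum_k E k *t Z k.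

Definition pencil : 'M[{poly C}]_(r * n) :=
  1%:M - 'X *: liftC (Delta *m A^~1).

(** Polynomial numerator of the resolvent map along t Z, over the denominator det [pencil]. *)
Definition Psi : 'M[{poly C}]_(q * n, r * n) :=
  liftC G^~1 *m \adj pencil.

Definition resolvent t : 'M[C]_(q * n, r * n) :=
  G^~1 *m invmx (1%:M - t *: (Delta *m A^~1)).

Lemma ev_pencil t : ev t pencil = 1%:M - t *: (Delta *m A^~1).
Proof.
rewrite map_mxB map_mx1 map_mxZ -map_mx_comp; congr (_ - _).
by apply/matrixP=> i j; rewrite !mxE /= /horner_eval hornerX hornerC.
Qed.

Lemma ev_liftC t p s (M : 'M[C]_(p, s)) : ev t (liftC M) = M.
Proof. by apply/matrixP=> i j; rewrite !mxE /horner_eval hornerC. Qed.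

Lemma pencil_unit t :
  (1%:M - t *: (Delta *m A^~1) \in unitmx) = ((\det pencil).[t] != 0).
Proof. by rewrite -ev_pencil unitmxE unitfE det_map_mx. Qed.

Lemma ev_Psi t : (\det pencil).[t] != 0 ->
  ev t Psi = (\det pencil).[t] *: resolvent t.
Proof.
move=> pt; rewrite map_mxM /= ev_liftC map_mx_adj scalemxAr; congr (_ *m _).
rewrite ev_pencil /invmx pencil_unit pt -ev_pencil det_map_mx scalerA.
by rewrite mulfV ?scale1r.
Qed.

Definition transfer_num : 'M[{poly C}]_(q * n) :=
  \det pencil *: liftC D^~1 + 'X *: (Psi *m liftC (Delta *m B^~1)).

Lemma liftC_T p s (M : 'M[C]_(p, s)) :
  liftC M^~1 = liftC M *t (1%:M : 'M[{poly C}]_n).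
Proof. by rewrite map_mxT map_mx1. Qed.

(** Applied with M = G for the transfer function and with M = A for the state map. *)
Lemma sum_shift m p (M : 'M[C]_(p, r)) :
  \sum_k (1%:M *t liftC (Z k))
     *m mser Z m (fun w => M *m E k *m words_AB w)
  = liftC (M^~1 *m Delta) *m mser Z m words_AB.
Proof.
rewrite map_mxM liftC_T /Delta raddf_sum mulmx_sumr mulmx_suml.
apply: eq_bigr => k _ /=; rewrite mser_mull map_mxT map_mxM.
by rewrite mulmxA !tensmx_mul mulmx1 !mul1mx.
Qed.

(* W below is the series of the state map: W = B + t A Delta W. *)
Lemma realization_fraction m f : global_transfer =1 f ->
  eqXmod m transfer_num (\det pencil *: mser Z m f).
Proof.
move=> Tf; rewrite -(eq_mser _ _ Tf); case: m => [|m]; first exact: eqXmod0.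
rewrite /= sum_shift scalerDr -liftC_T.
apply: eqXmodD; first exact: eqXmod_refl.
rewrite scalerA mulrC -scalerA; apply: eqXmod_mulX.
set W := mser Z m words_AB.
have BE : eqXmod m (liftC B^~1) ((1%:M - 'X *: liftC (A^~1 *m Delta)) *m W).
  have := mserS Z m words_AB; rewrite -/W /= sum_shift -liftC_T => H.
  have := eqXmodD (eqXmod_refl m (- ('X *: (liftC (A^~1 *m Delta) *m W)))) H.
  rewrite addrC addrK addrC mulmxBl mul1mx -scalemxAl.
  exact.
rewrite map_mxM mulmxA; apply: eqXmod_trans (eqXmod_mull _ BE) _.
suff -> : Psi *m liftC Delta *m ((1%:M - 'X *: liftC (A^~1 *m Delta)) *m W)
    = \det pencil *: (liftC (G^~1 *m Delta) *m W) by exact: eqXmod_refl.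
rewrite mulmxA scalemxAl; congr (_ *m _).
(* Push-through identity: Delta (I - t A Delta) = (I - t Delta A) Delta. *)
have -> : Psi *m liftC Delta *m (1%:M - 'X *: liftC (A^~1 *m Delta))
    = Psi *m pencil *m liftC Delta.
  rewrite -!mulmxA; congr (_ *m _); rewrite mulmxBr mulmxBl mulmx1 mul1mx.
  by rewrite -scalemxAr -scalemxAl -!map_mxM mulmxA.
rewrite /Psi -[_ *m pencil]mulmxA mul_adj_mx.
by rewrite mul_mx_scalar map_mxM -scalemxAl.
Qed.

(** The expression gives P / d and the realization gives [transfer_num] / det [pencil], with the
    same series at 0. Cross-multiplying yields an identity modulo every power of X, hence an
    identity of polynomials. *)
Lemma value_realization F f : mx_denotes F f -> global_transfer =1 f ->
  exists P d, [/\ d.[0] != 0,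
    forall t, (forall i j, regular (fun k => t *: Z k) (F i j)) <->
              d.[t] != 0,
    forall t, d.[t] != 0 ->
      d.[t] *: (\sum_i \sum_j (delta_mx i j : 'M[C]_q)
                  *t eval (fun k => t *: Z k) (F i j)) = ev t P &
    forall t, d.[t] != 0 -> (\det pencil).[t] != 0 ->
      \sum_i \sum_j (delta_mx i j : 'M[C]_q)
                  *t eval (fun k => t *: Z k) (F i j)
      = D^~1 + t *: (resolvent t *m Delta *m B^~1)].
Proof.
move=> /(mx_expr_fraction Z) [P [d [d0 PE regE valE]]] Tf.
have eqP : \det pencil *: P = d *: transfer_num.
  apply: eqXmod_eq => m.
  apply: eqXmod_trans (eqXmodZ _ (PE m)) _.
  rewrite scalerA mulrC -scalerA; apply/eqXmodZ/eqXmod_sym.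
  exact: realization_fraction.
exists P, d; split=> // t dt pt; apply: (scalerI dt); apply: (scalerI pt).
rewrite valE //; have := congr1 (ev t) eqP; rewrite !map_mxZ /= => ->.
rewrite scalerA mulrC -scalerA; congr (_ *: _).
rewrite map_mxD !map_mxZ map_mxM /= !ev_liftC ev_Psi // /horner_eval hornerX.
by rewrite scalerDr -scalemxAl mulmxA !scalerA [t * _]mulrC.
Qed.
End Realization.

(** * Positive semidefinite matrices *)

Section ConjTranspose.
Variable (C : numClosedFieldType).

Lemma ctmxM p q r (A : 'M[C]_(p, q)) (B : 'M[C]_(q, r)) :
  (A *m B)^t* = B^t* *m A^t*.
Proof. by rewrite trmx_mul map_mxM. Qed.

Lemma ctmx_tens p q r s (A : 'M[C]_(p, q)) (B : 'M[C]_(r, s)) :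
  (A *t B)^t* = A^t* *t B^t*.
Proof. by rewrite trmx_tens map_mxT. Qed.

Lemma ctmxB p q (A B : 'M[C]_(p, q)) : (A - B)^t* = A^t* - B^t*.
Proof. by rewrite linearB /= map_mxB. Qed.

Lemma ctmx1 p : (1%:M : 'M[C]_p)^t* = 1%:M.
Proof. by rewrite trmx1 map_mx1. Qed.

Lemma ctmxZ p q c (A : 'M[C]_(p, q)) : (c *: A)^t* = c^* *: A^t*.
Proof. by rewrite linearZ /= map_mxZ. Qed.

Lemma ctmx_sum p q (I : finType) (F : I -> 'M[C]_(p, q)) :
  (\sum_i F i)^t* = \sum_i (F i)^t*.
Proof. by rewrite linear_sum /= (raddf_sum (map_mx _)). Qed.

Lemma ctmx_inv p (A : 'M[C]_p) : (invmx A)^t* = invmx (A^t*).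
Proof. by rewrite trmx_inv map_invmx. Qed.

End ConjTranspose.

Section Positive.
Variable (C : numClosedFieldType).

Lemma gram_ge0 p (x : 'cV[C]_p) : 0 <= (x^t* *m x) 0 0.
Proof.
rewrite mxE sumr_ge0 // => i _; rewrite !mxE mulrC; exact: mul_conjC_ge0.
Qed.

Lemma gram_eq0 p (x : 'cV[C]_p) : (x^t* *m x) 0 0 = 0 -> x = 0.
Proof.
rewrite mxE => /eqP; rewrite psumr_eq0 => [|i _]; last first.
  by rewrite !mxE mulrC; exact: mul_conjC_ge0.
move/allP=> x0; apply/colP=> i; rewrite mxE.
have := x0 i; rewrite mem_index_enum !mxE mulrC mul_conjC_eq0.
by move/(_ isT)/eqP.
Qed.

Lemma psd_congr p q (M : 'M[C]_p) (T : 'M[C]_(p, q)) :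
  psdmx M -> psdmx (T^t* *m M *m T).
Proof. by move=> Mge0 x; rewrite !mulmxA -ctmxM -mulmxA; apply: Mge0. Qed.

Lemma psd_congr_ct p q (M : 'M[C]_p) (T : 'M[C]_(q, p)) :
  psdmx M -> psdmx (T *m M *m T^t*).
Proof. by move/(psd_congr (T^t*)); rewrite trmxCK. Qed.

Lemma psd1 p : psdmx (1%:M : 'M[C]_p).
Proof. by move=> x; rewrite mulmx1 gram_ge0. Qed.

Lemma psd_gram p q (T : 'M[C]_(q, p)) : psdmx (T^t* *m T).
Proof. by have := psd_congr T (@psd1 q); rewrite mulmx1. Qed.

Lemma psd0 p : psdmx (0 : 'M[C]_p).
Proof. by move=> x; rewrite mulmx0 mul0mx mxE. Qed.

Lemma psdD p (M M' : 'M[C]_p) : psdmx M -> psdmx M' -> psdmx (M + M').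
Proof.
by move=> HM HM' x; rewrite mulmxDr mulmxDl mxE addr_ge0.
Qed.

Lemma psdZ p c (M : 'M[C]_p) : 0 <= c -> psdmx M -> psdmx (c *: M).
Proof.
by move=> c0 HM x; rewrite -scalemxAr -scalemxAl mxE mulr_ge0.
Qed.

Lemma psd_sum p (I : finType) (F : I -> 'M[C]_p) :
  (forall i, psdmx (F i)) -> psdmx (\sum_i F i).
Proof.
move=> HF; elim/big_ind: _ => //; first exact: psd0.
by move=> M M'; apply: psdD.
Qed.

(** Spectral theorem: T is the square root of the diagonal of eigenvalues times the diagonalizing
    unitary. *)
Lemma psd_factor p (M : 'M[C]_p) :
  M^t* = M -> psdmx M -> exists T : 'M[C]_p, M = T^t* *m T.
Proof.
move=> herm Mge0.
have /orthomx_spectralP : M \is normalmx by apply/normalmxP; rewrite herm.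
set P := spectralmx M; set sp := spectral_diag M => ME.
have Pu : P \is unitarymx := spectral_unitarymx M.
rewrite invmx_unitary // in ME.
have spE : diag_mx sp = P *m M *m P^t*.
  rewrite ME !mulmxA (unitarymxP Pu) mul1mx -mulmxA (unitarymxP Pu).
  by rewrite mulmx1.
have sp_ge0 i : 0 <= sp 0 i.
  pose e : 'cV[C]_p := delta_mx i 0.
  have := Mge0 (P^t* *m e).
  have -> : (P^t* *m e)^t* *m M *m (P^t* *m e) = e^t* *m diag_mx sp *m e.
    by rewrite spE ctmxM trmxCK !mulmxA.
  rewrite trmx_delta map_delta_mx -rowE -colE !mxE.
  by rewrite eqxx mulr1n.
exists (diag_mx (map_mx sqrtC sp) *m P).
rewrite ctmxM !mulmxA -(mulmxA (P^t*)) {1}ME; congr (_ *m _ *m _).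
rewrite tr_diag_mx map_diag_mx mulmx_diag; congr diag_mx.
apply/rowP=> i; rewrite !mxE.
have s0 : 0 <= sqrtC (sp 0 i) by rewrite sqrtC_ge0.
by rewrite /= conj_Creal ?ger0_real // -expr2 sqrtCK.
Qed.

Lemma psd_tens p q (M : 'M[C]_p) (Q : 'M[C]_q) :
  M^t* = M -> psdmx M -> Q^t* = Q -> psdmx Q -> psdmx (M *t Q).
Proof.
move=> Mh /(psd_factor Mh) [T ->] Qh /(psd_factor Qh) [S ->].
rewrite -tensmx_mul -ctmx_tens; exact: psd_gram.
Qed.

Lemma psd_unit_posdef p (M : 'M[C]_p) :
  M^t* = M -> psdmx M -> M \in unitmx -> posdefmx M.
Proof.
move=> Mh /[dup] Mge0 /(psd_factor Mh) [T ME] Mu x x0.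
rewrite lt_def Mge0 andbT; apply: contra x0.
rewrite ME !mulmxA -ctmxM -mulmxA => /eqP/gram_eq0 Tx0.
by rewrite -(mulKmx Mu x) ME -mulmxA Tx0 !mulmx0.
Qed.

Lemma posdef_psd p (M : 'M[C]_p) : posdefmx M -> psdmx M.
Proof.
move=> Mgt0 x; have [->|/Mgt0/ltW//] := eqVneq x 0.
by rewrite mulmx0 mxE.
Qed.

End Positive.

(** * Points off the zeros of a polynomial *)

Section GenericPoint.
Variable (C : numClosedFieldType).

Lemma injective_non_root (s : nat -> C) (b : {poly C}) :
  injective s -> b != 0 -> exists m, b.[s m] != 0.
Proof.
move=> s_inj b0; case: (boolP (all (root b) (mkseq s (size b)))).
  move=> /(max_poly_roots b0); rewrite map_inj_uniq ?iota_uniq //.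
  by move/(_ isT); rewrite size_mkseq ltnn.
by case/allPn=> x /mapP[m _ ->] ?; exists m.
Qed.

(* Replaces a limit: |p(t) - p(1)| <= (1 - t) sup |g| for the cofactor g of
   the root 1 of p - p(1). *)
Lemma poly_ge0_at1 (p b : {poly C}) : b != 0 -> p.[1] \is Num.real ->
  (forall t, 0 <= t < 1 -> b.[t] != 0 -> 0 <= p.[t]) -> 0 <= p.[1].
Proof.
move=> b0 p1_real p_ge0; rewrite real_leNgt ?rpred0 //; apply/negP=> p1_lt0.
have /factor_theorem[g gE] : root (p - p.[1]%:P) 1.
  by rewrite /root hornerD hornerN hornerC subrr.
have [ub ub_g] := poly_disk_bound g 1.
have ub_ge0 : 0 <= ub by rewrite (le_trans (normr_ge0 g.[0])) ?ub_g ?normr0.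
(* Chosen so that c <= 1 and ub * c < - p.[1]; the points 1 - c / (m + 1) then lie in [0, 1), are
   too close to 1 for p to be non-negative there, and are infinitely many, so one of them is no root
   of b. *)
pose c := - p.[1] / (ub + 1 - p.[1]).
have p1_gt0 : 0 < - p.[1] by rewrite oppr_gt0.
have den_gt0 : 0 < ub + 1 - p.[1] by rewrite addr_gt0 // ltr_wpDl.
have c_gt0 : 0 < c by rewrite divr_gt0.
have c_le1 : c <= 1.
  by rewrite ler_pdivrMr // mul1r lerDr addr_ge0.
have ubc : ub * c < - p.[1].
  rewrite mulrCA -[ltRHS]mulr1 ltr_pM2l // ltr_pdivrMr // mul1r.
  by rewrite -addrA ltrDl addr_gt0.
have [|m] := @injective_non_root (fun m => 1 - c / m.+1%:R) b _ b0.
  move=> m1 m2 /addrI/oppr_inj/(mulfI (lt0r_neq0 c_gt0))/invr_inj/eqP.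
  by rewrite eqr_nat eqSS => /eqP.
set u := c / _; set t := 1 - u => bt.
have u_gt0 : 0 < u by rewrite divr_gt0 ?ltr0n.
have u_lec : u <= c.
  by rewrite ler_pdivrMr ?ltr0n // ler_peMr ?ler1n // ltW.
have t_ge0 : 0 <= t by rewrite subr_ge0 (le_trans u_lec).
have t_lt1 : t < 1 by rewrite gtrBl.
have ptE : p.[t] - p.[1] = - (g.[t] * u).
  have := congr1 (horner^~ t) gE.
  rewrite /= hornerD hornerN hornerC hornerM hornerXsubC => ->.
  by rewrite /t addrAC subrr add0r mulrN.
have pt_ge0 : 0 <= p.[t] by rewrite p_ge0 ?t_ge0.
have : `|p.[t] - p.[1]| < - p.[1].
  rewrite ptE normrN normrM (gtr0_norm u_gt0); apply: le_lt_trans ubc.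
  by rewrite ler_pM ?normr_ge0 ?(ltW u_gt0) // ub_g // ger0_norm // ltW.
rewrite ger0_norm ?addr_ge0 ?(ltW p1_gt0) // gtrDr.
by move/(le_lt_trans pt_ge0); rewrite ltxx.
Qed.

End GenericPoint.

(** * The defect of a J-unitary realization *)

Section EvalExt.
Variables (C : numClosedFieldType) (N n : nat) (Z Z' : 'I_N -> 'M[C]_n).
Hypothesis ZZ' : Z =1 Z'.

Lemma eq_eval e : eval Z e = eval Z' e.
Proof. by elim: e => //= [a -> b ->|a -> b ->|a ->]. Qed.

Lemma eq_regular e : regular Z e = regular Z' e.
Proof. by elim: e => //= [a -> b ->|a -> b ->|a ->]; rewrite ?eq_eval. Qed.

Lemma eq_value q (F : 'I_q -> 'I_q -> ncexpr C N) :
  \sum_i \sum_j (delta_mx i j : 'M[C]_q) *t eval Z (F i j)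
  = \sum_i \sum_j (delta_mx i j : 'M[C]_q) *t eval Z' (F i j).
Proof. by do 2!apply: eq_bigr => ? _; rewrite eq_eval. Qed.

End EvalExt.

Section Colligation.
Variables (C : numClosedFieldType) (r q : nat).
Implicit Types (A K H : 'M[C]_r) (B : 'M[C]_(r, q)) (G : 'M[C]_(q, r)).
Implicit Types (D J : 'M[C]_q).

(** Kept blockwise so that each identity can be tensored with the identity of C^n separately. *)
Definition coisometric A B G D K J : Prop :=
  [/\ A *m K *m A^t* + B *m J *m B^t* = K,
      A *m K *m G^t* + B *m J *m D^t* = 0,
      G *m K *m A^t* + D *m J *m B^t* = 0 &
      G *m K *m G^t* + D *m J *m D^t* = J].

Lemma coisometricP A B G D K J :
  coisometric A B G D K J <->
  block_mx A B G D *m block_mx K 0 0 J *m (block_mx A B G D)^t*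
    = block_mx K 0 0 J.
Proof.
rewrite tr_block_mx map_block_mx !mulmx_block !mulmx0 !addr0 !add0r.
split=> [[-> -> -> ->] //|/eq_block_mx[? ? ? ?]]; split; assumption.
Qed.

Lemma row_mx_quad p (X : 'M[C]_(p, r)) (Y : 'M[C]_(p, q)) K J :
  row_mx X Y *m block_mx K 0 0 J *m (row_mx X Y)^t*
    = X *m K *m X^t* + Y *m J *m Y^t*.
Proof.
rewrite mul_row_block !mulmx0 addr0 add0r tr_row_mx map_col_mx.
by rewrite mul_row_col.
Qed.

(** With U the colligation, (T, V) = (T X, 1) U, and U diag(K, J) U^* = diag(K, J); hence T K T^* +
    V J V^* = T X K X^* T^* + J. *)
Lemma coisometric_defect A B G D K J (X : 'M[C]_r) :
  coisometric A B G D K J -> 1%:M - X *m A \in unitmx ->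
  let T := G *m invmx (1%:M - X *m A) in
  let V := D + T *m X *m B in
  J - V *m J *m V^t* = T *m (K - X *m K *m X^t*) *m T^t*.
Proof.
move=> /coisometricP Uco Xu T V; set Y := T *m X.
have TV : row_mx T V = row_mx Y 1%:M *m block_mx A B G D.
  rewrite mul_row_block !mul1mx [_ + D]addrC; congr row_mx.
  have TX : T *m (1%:M - X *m A) = G by rewrite /T mulmxKV.
  by rewrite -TX mulmxBr mulmx1 mulmxA addrC subrK.
have := row_mx_quad T V K J; rewrite TV ctmxM !mulmxA.
rewrite -[_ *m block_mx K _ _ _]mulmxA -[_ *m (block_mx _ _ _ _)^t*]mulmxA.
rewrite Uco row_mx_quad ctmx1 mul1mx mulmx1 => E.
have -> : V *m J *m V^t* = Y *m K *m Y^t* + J - T *m K *m T^t*.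
  by rewrite E addrC addKr.
rewrite mulmxBr mulmxBl /Y ctmxM !mulmxA.
by rewrite opprB addrCA [_ + J]addrC opprD [J + _]addrA subrr add0r.
Qed.

(** Since J is its own inverse, diag(H^-1, J) U^* diag(H, J) is a left inverse of the square matrix
    U, hence also a right inverse. *)
Lemma isometric_coisometric A B G D H J :
  J *m J = 1%:M -> H \in unitmx ->
  (block_mx A B G D)^t* *m block_mx H 0 0 J *m block_mx A B G D
    = block_mx H 0 0 J ->
  coisometric A B G D (invmx H) J.
Proof.
move=> JJ Hu Uiso; apply/coisometricP.
set U := block_mx A B G D in Uiso *.
set HJ := block_mx H 0 0 J in Uiso; set KJ := block_mx _ _ _ _.
have KH : KJ *m HJ = 1%:M.
  rewrite mulmx_block !mulmx0 !mul0mx !addr0 !add0r JJ mulVmx //.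
  by rewrite -scalar_mx_block.
have HK : HJ *m KJ = 1%:M by apply: mulmx1C.
have : KJ *m U^t* *m HJ *m U = 1%:M.
  by rewrite -!mulmxA (mulmxA (U^t*)) Uiso.
move/mulmx1C => UK; rewrite -[RHS]mul1mx -UK -!mulmxA HK mulmx1.
by rewrite !mulmxA.
Qed.

End Colligation.

Section GlobalNode.
Variables (C : numClosedFieldType) (N r q : nat) (E : 'I_N -> 'M[C]_r).
Variables (A : 'M[C]_r) (B : 'M[C]_(r, q)) (G : 'M[C]_(q, r)) (D : 'M[C]_q).
Variables (K : 'M[C]_r) (J : 'M[C]_q).

Hypothesis E_orth : forall k l, E k *m E l = if k == l then E k else 0.
Hypothesis E_sum : \sum_k E k = 1%:M.
Hypothesis E_herm : forall k, (E k)^t* = E k.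
Hypothesis EK : forall k, E k *m K = K *m E k.
Hypothesis UK : coisometric A B G D K J.

Section Point.
Variables (n : nat) (W : 'I_N -> 'M[C]_n) (t : C).
Local Notation "M ^~1" := (M *t (1%:M : 'M[C]_n)) (at level 8).
Local Notation Dl := (Delta W E).

Lemma coisometric_tens :
  coisometric A^~1 B^~1 G^~1 D^~1 K^~1 J^~1.
Proof.
case: UK => AA AG GA GG; rewrite /coisometric !ctmx_tens ctmx1 !tensmx_mul.
by rewrite !mulmx1 -!tensmxDl AA AG GA GG !tens0mx; split.
Qed.

(** The cross terms E_k K E_l with k <> l vanish because K commutes with the orthogonal
    projections. *)
Lemma Delta_defect :
  K^~1 - (t *: Dl) *m K^~1 *m (t *: Dl)^t*
  = \sum_k (E k *m K) *t (1%:M - (t * t^*) *: (W k *m (W k)^t*)).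
Proof.
under eq_bigr do rewrite tensmxBr.
rewrite big_split sumrN -tensmx_suml -mulmx_suml E_sum mul1mx; congr (_ - _).
rewrite ctmxZ -!scalemxAl -scalemxAr scalerA.
under eq_bigr do rewrite tensmxZr.
rewrite -scaler_sumr; congr (_ *: _).
rewrite ctmx_sum mulmx_suml mulmx_suml; apply: eq_bigr => k _.
rewrite mulmx_sumr (bigD1 k) //= big1 => [|l lk]; last first.
  rewrite ctmx_tens !tensmx_mul E_herm EK -(mulmxA K) E_orth eq_sym.
  by rewrite (negPf lk) mulmx0 tens0mx.
by rewrite addr0 ctmx_tens !tensmx_mul E_herm EK -(mulmxA K) E_orth eqxx mulmx1.
Qed.

Lemma value_defect (T := resolvent W E A G t)
    (V := D^~1 + t *: (T *m Dl *m B^~1)) :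
  (\det (pencil W E A)).[t] != 0 ->
  J^~1 - V *m J^~1 *m V^t* =
  T *m (\sum_k (E k *m K) *t (1%:M - (t * t^*) *: (W k *m (W k)^t*))) *m T^t*.
Proof.
rewrite -pencil_unit -Delta_defect => pu.
have XA : (t *: Dl) *m A^~1 = t *: (Dl *m A^~1) by rewrite -scalemxAl.
have VE : V = D^~1 + T *m (t *: Dl) *m B^~1.
  by rewrite /V -scalemxAr -scalemxAl.
have := @coisometric_defect _ _ _ _ _ _ _ _ _ (t *: Dl) coisometric_tens.
by rewrite XA VE; apply.
Qed.

End Point.

Lemma det_pencil0 n (W : 'I_N -> 'M[C]_n) : (\det (pencil W E A)).[0] = 1.
Proof.
rewrite -[_.[0]]/(horner_eval 0 _) -det_map_mx /= ev_pencil scale0r subr0.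
exact: det1.
Qed.

Lemma poly_neq0_at (p : {poly C}) t : p.[t] != 0 -> p != 0.
Proof. by apply: contra_neq => ->; rewrite horner0. Qed.

Lemma EK_herm k : K^t* = K -> (E k *m K)^t* = E k *m K.
Proof. by move=> Kh; rewrite ctmxM Kh E_herm EK. Qed.

Lemma EK_quad k : E k *m K = E k *m K *m (E k)^t*.
Proof. by rewrite E_herm EK -mulmxA E_orth eqxx. Qed.

(** At t W with 0 <= t < 1, off finitely many t, [value_defect] gives the inequality. At t = 1 the
    resolvent may be singular although the expression is regular, so the quadratic form at x is
    cleared of denominators and [poly_ge0_at1] reaches the endpoint. *)
Lemma contractive_of_psd f n (W : 'I_N -> 'M[C]_n) V :
  K^t* = K -> psdmx K -> J^t* = J ->
  global_transfer E A B G D =1 f ->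
  (forall k, lemx (W k *m (W k)^t*) 1%:M) -> has_value f W V ->
  lemx (V *m (J *t 1%:M) *m V^t*) (J *t 1%:M).
Proof.
move=> Kh K_ge0 Jh fE W_le1 [F [Ff Freg ->]] x.
have [P [d [d0 regE valE VE]]] := value_realization W Ff fE.
have W1 : (fun k => 1 *: W k) =1 W by move=> k; rewrite scale1r.
have d1 : d.[1] != 0 by apply/regE => i j; rewrite (eq_regular W1).
have := valE 1 d1; rewrite (eq_value W1).
set V1 := \sum_i _ => V1E.
set J1 : 'M[C]_(q * n) := J *t 1%:M.
have J1h : J1^t* = J1 by rewrite ctmx_tens Jh ctmx1.
(* Only coefficients are conjugated, so [Pc] is the adjoint of P, and [dd] is |d|^2, at real t;
   there M is |d|^2 times the defect of P / d. *)
pose Pc := map_mx (map_poly (@Num.conj C)) P^T.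
pose dd := d * map_poly (@Num.conj C) d.
pose M := dd *: map_mx polyC J1 - P *m map_mx polyC J1 *m Pc.
pose p := (map_mx polyC (x^t*) *m M *m map_mx polyC x) 0 0.
have pE t (v := d.[t]^-1 *: map_mx (horner_eval t) P) :
    t \is Num.real -> d.[t] != 0 ->
    p.[t] = (d.[t] * d.[t]^*) * (x^t* *m (J1 - v *m J1 *m v^t*) *m x) 0 0.
  move=> t_real dt.
  have conj_t (s : {poly C}) : (map_poly (@Num.conj C) s).[t] = (s.[t])^*.
    by rewrite -{1}(CrealP t_real) horner_map.
  have PcE : map_mx (horner_eval t) Pc = (map_mx (horner_eval t) P)^t*.
    by apply/matrixP=> i j; rewrite !mxE /horner_eval conj_t.
  have -> : p.[t] = map_mx (horner_eval t)
      (map_mx polyC (x^t*) *m M *m map_mx polyC x) 0 0 by rewrite [RHS]mxE.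
  rewrite !map_mxM /= !ev_liftC map_mxB map_mxZ !map_mxM /= !ev_liftC PcE.
  rewrite /dd /horner_eval hornerM conj_t.
  set w := map_mx _ P in v *; have -> : w = d.[t] *: v.
    by rewrite /v scalerA mulfV ?scale1r.
  move: v => v; rewrite ctmxZ -!scalemxAl -scalemxAr scalerA -scalerBr.
  by rewrite -scalemxAr -scalemxAl mxE.
have v1E : d.[1]^-1 *: map_mx (horner_eval 1) P = V1.
  by rewrite -V1E scalerA mulVf ?scale1r.
have herm_real (S : 'M[C]_(q * n)) : S^t* = S ->
    (x^t* *m S *m x) 0 0 \is Num.real.
  move=> Sh; apply/CrealP; set z := _ *m x.
  have -> : (z 0 0)^* = z^t* 0 0 by rewrite !mxE.
  by rewrite /z !ctmxM trmxCK Sh mulmxA.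
have dd_ge0 t : 0 <= d.[t] * d.[t]^* by apply: mul_conjC_ge0.
have : 0 <= p.[1].
  apply: (@poly_ge0_at1 _ p (d * \det (pencil W E A))).
  - rewrite mulf_neq0 // ; first exact: poly_neq0_at d1.
    by apply: (@poly_neq0_at _ 0); rewrite det_pencil0 oner_eq0.
  - rewrite pE ?rpred1 // rpredM ?(ger0_real (dd_ge0 _)) // herm_real //.
    by rewrite ctmxB !ctmxM trmxCK J1h mulmxA.
  move=> t /andP[t_ge0 t_lt1]; rewrite hornerM mulf_eq0 negb_or.
  case/andP=> dt pt; rewrite pE ?ger0_real // mulr_ge0 //.
  rewrite -valE // scalerA mulVf // scale1r VE // value_defect //.
  apply: psd_congr_ct; apply: psd_sum => k.
  apply: psd_tens; first exact: EK_herm.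
  - by rewrite EK_quad EK -EK; apply: psd_congr_ct.
  - by rewrite ctmxB ctmx1 ctmxZ ctmxM trmxCK rmorphM /= conjCK mulrC.
  rewrite (CrealP (ger0_real t_ge0)).
  have -> : 1%:M - (t * t) *: (W k *m (W k)^t*) =
      (1%:M - W k *m (W k)^t*) + (1 - t * t) *: (W k *m (W k)^t*).
    by rewrite scalerBl scale1r addrA subrK.
  apply: psdD; first exact: W_le1.
  apply: psdZ; first by rewrite subr_ge0 mulr_ile1 // ltW.
  by have := psd_congr_ct (W k) (@psd1 C n); rewrite mulmx1.
rewrite pE ?rpred1 // v1E pmulr_rge0 //.
by rewrite lt_def dd_ge0 andbT mulf_neq0 ?conjC_eq0.
Qed.

End GlobalNode.

(** * Shifts on words *)

(** Induction on the size of S: an extension s from S minus a is followed by the transposition of s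
    a and f a, which moves none of the other images. *)
Lemma perm_extension (T : finType) (f : T -> T) (S : {set T}) :
  {in S &, injective f} -> exists s : {perm T}, {in S, s =1 f}.
Proof.
elim: {S}#|S| {-2}S (leqnn #|S|) => [|m IHm] S.
  by rewrite leqn0 cards_eq0 => /eqP-> _; exists 1%g => x; rewrite inE.
have [->|[a aS]] := set_0Vmem S => Sm f_inj.
  by exists 1%g => x; rewrite inE.
have [||s sf] := IHm (S :\ a).
- by move: Sm; rewrite (cardsD1 a) aS.
- by move=> x y /setD1P[_ xS] /setD1P[_ yS]; apply: f_inj.
exists (s * tperm (s a) (f a))%g => x xS; rewrite permM.
have [->|xa] := eqVneq x a; first by rewrite tpermL.
have sx : s x = f x by apply: sf; rewrite in_setD1 xa.
rewrite tpermD ?sx //; first by rewrite -sx (inj_eq perm_inj) eq_sym.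
by apply: contra_neq xa => /f_inj ->.
Qed.

Section WordShift.
Variables (N L : nat).
Local Notation T := (L.-bseq 'I_N).

(** When w already has length L the default value is the empty word; [cons_word] is used on shorter
    words only. *)
Definition cons_word (k : 'I_N) (w : T) : T := insubd [bseq] (k :: w).

Lemma cons_wordE k (w : T) : (size w < L)%N -> cons_word k w = k :: w :> seq _.
Proof. by move=> wL; rewrite /cons_word insubdK. Qed.

Lemma word_shift (k : 'I_N) : exists s : {perm T},
  forall w : T, (size w < L)%N -> s w = cons_word k w.
Proof.
have [|s sE] := @perm_extension _ (cons_word k) [set w : T | size w < L]%N.
  move=> v w; rewrite !inE => vL wL /(congr1 val) /=.
  by rewrite !cons_wordE // => -[/val_inj].
by exists s => w wL; apply: sE; rewrite inE.
Qed.

End WordShift.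

Section Fock.
Variables (C : numClosedFieldType) (N L : nat) (k0 : 'I_N).
Local Notation T := (L.-bseq 'I_N).
Variable (s : 'I_N -> {perm T}).
Hypothesis sE : forall k (w : T), (size w < L)%N -> s k w = cons_word k w.
Local Notation n := #|{: T}|.

Definition unit_mx (v w : T) : 'M[C]_n := delta_mx (enum_rank v) (enum_rank w).
Local Notation vac := ([bseq] : T).
Local Notation P0 := (unit_mx vac vac).

Definition shift_mx k : 'M[C]_n :=
  \matrix_(i, j) (enum_val i == s k (enum_val j))%:R.

(* Contractive, with defect supported at k0 on the empty word. *)
Definition cut_shift k : 'M[C]_n :=
  (if k == k0 then 1%:M - P0 else 1%:M) *m shift_mx k.

Lemma unit_mxM u v w x :
  unit_mx u v *m unit_mx w x = if v == w then unit_mx u x else 0.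
Proof.
rewrite mul_delta_mx_cond (inj_eq enum_rank_inj).
by case: eqP => _; rewrite ?mulr1n ?mulr0n.
Qed.

Lemma unit_mx_shift k v w :
  unit_mx v (s k w) *m shift_mx k = unit_mx v w.
Proof.
apply/matrixP=> i j; rewrite !mxE (bigD1 (enum_rank (s k w))) //= big1.
  rewrite addr0 !mxE eqxx andbT enum_rankK (inj_eq perm_inj).
  rewrite -natrM mulnb; congr ((_ && _)%:R).
  by rewrite -[RHS](inj_eq enum_val_inj) enum_rankK eq_sym.
by move=> l lw; rewrite !mxE (negPf lw) andbF mul0r.
Qed.

Lemma shift_mx_unitary k : shift_mx k *m (shift_mx k)^t* = 1%:M.
Proof.
apply/matrixP=> i j; rewrite !mxE.
rewrite (bigD1 (enum_rank ((s k)^-1%g (enum_val i)))) //= big1.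
  rewrite !mxE !enum_rankK !permKV eqxx addr0 mul1r rmorph_nat.
  by rewrite (inj_eq enum_val_inj) eq_sym.
move=> l li; rewrite !mxE.
case: eqP => [il|_]; last by rewrite mul0r.
by case/eqP: li; rewrite il permK enum_valK.
Qed.

Lemma unit_mx_ct v w : (unit_mx v w)^t* = unit_mx w v.
Proof. by rewrite trmx_delta map_delta_mx. Qed.

Lemma cut_shift_defect k :
  1%:M - cut_shift k *m (cut_shift k)^t* = if k == k0 then P0 else 0.
Proof.
rewrite ctmxM mulmxA -(mulmxA _ (shift_mx k)) shift_mx_unitary mulmx1.
case: eqP => _; last by rewrite mul1mx ctmx1 subrr.
rewrite ctmxB ctmx1 unit_mx_ct mulmxBr mulmx1 mulmxBl mul1mx unit_mxM eqxx.
by rewrite subrr subr0 opprB addrC subrK.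
Qed.

Lemma unit_mx_cut_shift k v w : s k w != vac ->
  unit_mx v (s k w) *m cut_shift k = unit_mx v w.
Proof.
move=> w0; rewrite /cut_shift; case: eqP => _; last first.
  by rewrite mul1mx unit_mx_shift.
by rewrite mulmxBl mul1mx mulmxBr mulmxA unit_mxM (negPf w0) mul0mx subr0
  unit_mx_shift.
Qed.

Section Node.
Variables (r q : nat) (E : 'I_N -> 'M[C]_r) (A : 'M[C]_r) (G : 'M[C]_(q, r)).
Local Notation "M ^~1" := (M *t (1%:M : 'M[C]_n)) (at level 8).
Local Notation Dl := (Delta cut_shift E).
Local Notation liftC := (map_mx (@polyC C)).
Local Notation ev t := (map_mx (horner_eval t)).
Local Notation pen := (pencil cut_shift E A).
Local Notation Ps := (Psi cut_shift E A G).

(** G * [words_EA] w * E k carries the observability block C_{j_1} A_{j_1 j_2} ... A_{j_n k} of w =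
    g_{j_1} ... g_{j_n}. *)
Fixpoint words_EA (w : seq 'I_N) : 'M[C]_r :=
  if w is j :: w' then E j *m A *m words_EA w' else 1%:M.

(** Coefficient of t^l in the Neumann series of (I - t Delta A)^-1, restricted to the empty word. *)
Definition orbit_mx l : 'M[C]_(r * n) :=
  iter l (mulmx (Dl *m A^~1)) (1%:M *t P0).

(* Before length L the shifts act freely on words, so only the product of
   blocks spelled by w itself contributes. *)
Lemma orbit_component l (w : T) : (l <= size w)%N ->
  (1%:M *t unit_mx vac w) *m orbit_mx l
  = (if size w == l then words_EA w else 0) *t P0.
Proof.
elim: l w => [|l IHl] w /=.
  move=> _; rewrite tensmx_mul mul1mx unit_mxM.
  have -> : (size w == 0)%N = (vac == w) by rewrite size_eq0 eq_sym.
  rewrite eq_sym; case: (eqVneq vac w) => [<-|_].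
    by congr (_ *t _).
  by rewrite tensmx0 tens0mx.
move=> lw; have [j [w' wE]] : exists j w', w = j :: w' :> seq _.
  by case: w lw => -[|j w'] //= _ _; exists j, w'.
have w'L : (size w' < L)%N by have := size_bseq w; rewrite wE.
pose v : T := Bseq (ltnW w'L).
have svw : s j v = w by apply: val_inj; rewrite sE //= cons_wordE.
have w_vac : w != vac by apply/eqP => /(congr1 (@bseqval _ _)); rewrite wE.
rewrite mulmxA /Delta mulmx_suml mulmx_sumr mulmx_suml (bigD1 j) //= big1.
  rewrite addr0 {1}tensmx_mul mulmx1 tensmx_mul mul1mx -svw.
  rewrite unit_mx_cut_shift ?svw // -[unit_mx vac v]mul1mx.
  rewrite -[E j *m A]mulmx1 -tensmx_mul -mulmxA IHl; last first.
    by move: lw; rewrite wE.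
  rewrite tensmx_mul mul1mx wE eqSS /=.
  by case: eqP => _; rewrite ?mulmx0.
(* A preimage u shorter than L would make w begin with k instead of j. So u has length at least L >
   l, and the induction hypothesis gives 0. *)
move=> k kj; pose u := ((s k)^-1)%g w.
have suw : s k u = w by rewrite permKV.
have uL : (L <= size u)%N.
  rewrite leqNgt; apply/negP => uL.
  have := congr1 val suw; rewrite sE //= cons_wordE // wE => -[kj' _].
  by rewrite kj' eqxx in kj.
have lu : (l < size u)%N by apply: leq_trans lw (leq_trans (size_bseq w) uL).
rewrite {1}tensmx_mul mulmx1 tensmx_mul mul1mx -suw.
rewrite unit_mx_cut_shift ?suw // -[unit_mx vac u]mul1mx.
rewrite -[E k *m A]mulmx1 -tensmx_mul -mulmxA IHl; last exact: ltnW.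
by rewrite gtn_eqF // tens0mx mulmx0.
Qed.

Lemma Psi_pencil : Ps *m pen = \det pen *: liftC G^~1.
Proof. by rewrite /Psi -mulmxA mul_adj_mx mul_mx_scalar. Qed.

(** Finite Neumann expansion; the exact remainder is X^l [Ps] applied to the l-th orbit matrix. *)
Lemma Psi_expansion l :
  eqXmod l (Ps *m liftC (orbit_mx 0))
    (\sum_(i < l) ('X^i * \det pen) *: liftC (G^~1 *m orbit_mx i)).
Proof.
suff H : Ps *m liftC (orbit_mx 0) =
    \sum_(i < l) ('X^i * \det pen) *: liftC (G^~1 *m orbit_mx i)
    + 'X^l *: (Ps *m liftC (orbit_mx l)) by exists (Ps *m liftC (orbit_mx l)).
elim: l => [|l IHl]; first by rewrite big_ord0 add0r expr0 scale1r.
rewrite big_ord_recr /= {1}IHl -addrA; congr (_ + _).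
rewrite exprSr -!scalerA -scalerDr; congr (_ *: _).
have -> : liftC (orbit_mx l.+1) = liftC (Dl *m A^~1) *m liftC (orbit_mx l).
  by rewrite -map_mxM.
rewrite [liftC (G^~1 *m _)]map_mxM [\det pen *: _]scalemxAl -Psi_pencil.
rewrite mulmxA scalemxAl -mulmxDl; congr (_ *m _).
by rewrite scalemxAr -mulmxDr /pencil subrK mulmx1.
Qed.

(** By [orbit_component], the terms of the expansion of degree below |w| have no component along
    w. *)
Lemma Psi_component (w : T) :
  eqXmod (size w).+1
    (liftC (1%:M *t unit_mx vac w) *m (Ps *m liftC (orbit_mx 0)))
    (('X^(size w) * \det pen) *: liftC ((G *m words_EA w) *t P0)).
Proof.
apply: eqXmod_trans (eqXmod_mull _ (Psi_expansion _)) _.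
rewrite mulmx_sumr big_ord_recr /= big1 ?add0r => [|i _]; last first.
  rewrite -scalemxAr -map_mxM mulmxA tensmx_mul mul1mx mulmx1.
  rewrite -[G]mulmx1 -[unit_mx vac w]mul1mx -tensmx_mul -mulmxA.
  rewrite orbit_component; last exact: ltnW.
  by rewrite gtn_eqF // tens0mx mulmx0 map_mx0 scaler0.
rewrite -scalemxAr -map_mxM mulmxA tensmx_mul mul1mx mulmx1.
rewrite -[G in G *t _]mulmx1 -[unit_mx vac w]mul1mx -tensmx_mul -mulmxA.
by rewrite orbit_component // eqxx tensmx_mul mul1mx; apply: eqXmod_refl.
Qed.

(* The component of Psi along w starts with t^|w| C_w, so after rescaling by
   t^(L - |w|) the Y-combination is t^L times a matrix invertible at t = 0. *)
Lemma generic_observability (Y : T -> 'M[C]_(r, q)) :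
  \sum_(w : T) Y w *m G *m words_EA w *m E k0 = E k0 ->
  E k0 *m E k0 = E k0 ->
  exists2 b : {poly C}, b != 0 & forall t, b.[t] != 0 ->
    exists S, S *m resolvent cut_shift E A G t *m (E k0 *t P0) = E k0 *t P0.
Proof.
move=> YE EE; set F := E k0 *t P0.
have P0P0 : P0 *m P0 = P0 by rewrite unit_mxM eqxx.
have FF : F *m F = F by rewrite tensmx_mul EE P0P0.
pose S := \sum_(w : T) 'X^(L - size w) *: liftC (Y w *t unit_mx vac w).
pose M := S *m Ps *m liftC F.
have [R RE] : eqXmod L.+1 M (('X^L * \det pen) *: liftC F).
  have -> : M = \sum_(w : T) 'X^(L - size w) *: (liftC (Y w *t 1%:M)
      *m (liftC (1%:M *t unit_mx vac w) *m (Ps *m liftC (orbit_mx 0)))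
      *m liftC (E k0)^~1).
    rewrite /M /S !mulmx_suml; apply: eq_bigr => w _.
    have -> : liftC (Y w *t unit_mx vac w)
        = liftC (Y w *t 1%:M) *m liftC (1%:M *t unit_mx vac w).
      by rewrite -map_mxM tensmx_mul mul1mx mulmx1.
    have -> : liftC F = liftC (orbit_mx 0) *m liftC (E k0)^~1.
      by rewrite -map_mxM tensmx_mul mul1mx mulmx1.
    by rewrite -!scalemxAl !mulmxA.
  have FE : F = \sum_(w : T) (Y w *m G *m words_EA w *m E k0) *t P0.
    by rewrite -tensmx_suml YE.
  rewrite FE raddf_sum scaler_sumr; apply: eqXmod_sum => w /=.
  have wL := size_bseq w.
  have [Q QE] := Psi_component w.
  exists (liftC (Y w *t 1%:M) *m Q *m liftC (E k0)^~1).
  rewrite QE mulmxDr mulmxDl scalerDr; congr (_ + _).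
    rewrite -scalemxAr -scalemxAl scalerA mulrA -exprD subnK //.
    congr (_ *: _); rewrite -!map_mxM !tensmx_mul mul1mx mulmx1 !mulmxA.
    by [].
  by rewrite -scalemxAr -scalemxAl scalerA -exprD addnS subnK.
have MF : M = 'X^L *: (((\det pen)%:M + 'X *: R) *m liftC F).
  have -> : M = M *m liftC F by rewrite /M -[RHS]mulmxA -map_mxM FF.
  rewrite RE !mulmxDl mul_scalar_mx -!scalemxAl -map_mxM FF scalerDr.
  by rewrite !scalerA -exprSr.
(* At 0 this is the identity, as det [pen] is 1 there, so it is invertible for all but finitely many
   t. The polynomial b also excludes t = 0 and the singular points of the resolvent. *)
pose Qm := (\det pen)%:M + 'X *: R.
exists ('X * \det pen * \det Qm).
  apply: (contraTneq _ (oner_neq0 C)) => /eqP.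
  rewrite !mulf_eq0 polyX_eq0 /= => /orP[]/eqP p0.
    by rewrite -(det_pencil0 E A cut_shift) p0 horner0 eqxx.
  have : (\det Qm).[0] = 1.
    rewrite -[_.[0]]/(horner_eval 0 _) -det_map_mx map_mxD map_mxZ.
    rewrite map_scalar_mx.
    by rewrite /= /horner_eval hornerX scale0r addr0 det_pencil0 det1.
  by rewrite p0 horner0 => <-; rewrite eqxx.
move=> t; rewrite !hornerM hornerX !mulf_eq0 !negb_or.
case/andP=> /andP[t0 pt] Qt.
have Qu : ev t Qm \in unitmx by rewrite unitmxE unitfE det_map_mx.
exists (t ^- L *: ((\det pen).[t] *: (invmx (ev t Qm) *m ev t S))).
have H : ev t S *m ((\det pen).[t] *: resolvent cut_shift E A G t) *m F
    = t ^+ L *: (ev t Qm *m F).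
  have := congr1 (ev t) MF.
  rewrite (map_mxM _ (S *m Ps)) (map_mxM _ S) map_mxZ (map_mxM _ Qm) /=.
  by rewrite !ev_liftC ev_Psi // /horner_eval hornerXn.
set Rt := resolvent _ _ _ _ _ in H *; set St := ev t S in H *.
have -> : t ^- L *: ((\det pen).[t] *: (invmx (ev t Qm) *m St)) *m Rt *m F
    = t ^- L *: (invmx (ev t Qm) *m (St *m ((\det pen).[t] *: Rt) *m F)).
  by rewrite -[St *m (_ *: _)]scalemxAr -!scalemxAl -scalemxAr !mulmxA.
by rewrite H -scalemxAr scalerA mulVf ?scale1r ?expf_neq0 // mulKmx.
Qed.

End Node.
End Fock.

(** The Cayley transforms (1 + i m) / (1 - i m) are infinitely many points of modulus one. *)
Lemma unit_circle_non_root (C : numClosedFieldType) (p : {poly C}) :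
  p != 0 -> exists t, t * t^* = 1 /\ p.[t] != 0.
Proof.
move=> p0; pose z m : C := 1 + 'i * m%:R; pose zc m : C := 1 - 'i * m%:R.
have zE m : (z m)^* = zc m.
  by rewrite rmorphD rmorph1 rmorphM /= conjCi rmorph_nat mulNr.
have zz m : z m * zc m = 1 + m%:R ^+ 2.
  by rewrite mulrC -subr_sqr expr1n exprMn sqrCi mulN1r opprK.
have zz0 m : z m * zc m != 0.
  by rewrite zz gt_eqF // ltr_wpDr ?ltr01 // exprn_ge0.
have z0 m : z m != 0 by have := zz0 m; rewrite mulf_eq0 => /norP[].
have zc0 m : zc m != 0 by have := zz0 m; rewrite mulf_eq0 => /norP[].
have [|m pm] := @injective_non_root _ (fun m => z m / zc m) _ _ p0.
  move=> a b /eqP; rewrite eqr_div // => /eqP H.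
  have : 'i * 2%:R * (a%:R - b%:R) = z a * zc b - z b * zc a.
    by rewrite /z /zc; ring.
  rewrite H subrr => /eqP; rewrite !mulf_eq0 (negPf (neq0Ci _)) pnatr_eq0 /=.
  by rewrite subr_eq0 eqr_nat => /eqP.
exists (z m / zc m); split=> //.
rewrite rmorphM /= fmorphV /= -!zE conjCK mulrA divfK ?mulfV //.
by rewrite zE.
Qed.

(** * From innerness to positivity of each block *)

Section GlobalConverse.
Variables (C : numClosedFieldType) (N r q : nat) (E : 'I_N -> 'M[C]_r).
Variables (A : 'M[C]_r) (B : 'M[C]_(r, q)) (G : 'M[C]_(q, r)) (D : 'M[C]_q).
Variables (K : 'M[C]_r) (J : 'M[C]_q) (f : fps N 'M[C]_q).

Hypothesis E_orth : forall k l, E k *m E l = if k == l then E k else 0.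
Hypothesis E_sum : \sum_k E k = 1%:M.
Hypothesis E_herm : forall k, (E k)^t* = E k.
Hypothesis EK : forall k, E k *m K = K *m E k.
Hypothesis UK : coisometric A B G D K J.
Hypothesis fE : global_transfer E A B G D =1 f.

(** Y witnesses observability of block k0. For |t| = 1 the defect at t Z is T (E_k0 K (x) P0) T^*,
    with T the resolvent map and P0 the projection onto the empty word; the S of
    [generic_observability] undoes T on that range. *)
Lemma psd_of_inner k0 L (Y : L.-bseq 'I_N -> 'M[C]_(r, q)) :
  \sum_(w : L.-bseq 'I_N) Y w *m G *m words_EA E A w *m E k0 = E k0 ->
  rational f -> matrix_J_inner J f -> psdmx (E k0 *m K).
Proof.
move=> YE [F Ff] [_ inner].
have [s sE] := fin_all_exists (@word_shift N L).
pose Z := cut_shift C k0 s.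
have EE : E k0 *m E k0 = E k0 by rewrite E_orth eqxx.
have [b b0 bE] := @generic_observability C N L k0 s sE _ _ E A G Y YE EE.
have [P [d [d0 regE valE VE]]] := value_realization Z Ff fE.
(* Non-roots of p are the t where S exists, F is regular at t Z and the resolvent is defined. *)
pose p := b * d * \det (pencil Z E A).
have p0 : p != 0.
  rewrite !mulf_neq0 //; first exact: poly_neq0_at d0.
  by apply: (@poly_neq0_at _ _ 0); rewrite det_pencil0 oner_eq0.
have [t [tt]] := unit_circle_non_root p0.
rewrite !hornerM !mulf_eq0 !negb_or => /andP[/andP[bt dt] pt].
have [S SE] := bE t bt.
have Z_defect k : 1%:M - (t *: Z k) *m (t *: Z k)^t* =
    if k == k0 then unit_mx C [bseq] [bseq] else 0.
  by rewrite ctmxZ -scalemxAl -scalemxAr scalerA tt scale1r cut_shift_defect.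
pose vac : L.-bseq 'I_N := [bseq].
pose P0 := unit_mx C vac vac.
have W_le1 k : lemx ((t *: Z k) *m (t *: Z k)^t*) 1%:M.
  rewrite /lemx Z_defect; case: ifP => _; last exact: psd0.
  have := psd_gram (unit_mx C vac vac).
  by rewrite unit_mx_ct unit_mxM eqxx.
have := inner _ _ _ W_le1 (ex_intro _ F (And3 Ff (proj2 (regE t) dt) erefl)).
rewrite /lemx VE // (value_defect E_orth E_sum E_herm EK UK) //.
rewrite (bigD1 k0) //= big1 => [|k kk]; last first.
  have := Z_defect k; rewrite (negPf kk) ctmxZ -scalemxAl -scalemxAr scalerA.
  by move=> ->; rewrite tensmx0.
have := Z_defect k0; rewrite eqxx ctmxZ -scalemxAl -scalemxAr scalerA => ->.
rewrite addr0 => /(psd_congr_ct S).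
set T := resolvent _ _ _ _ _; rewrite -/P0.
have KP : (E k0 *m K) *t P0
    = (E k0 *t P0) *m (K *t 1%:M) *m (E k0 *t P0)^t*.
  rewrite ctmx_tens unit_mx_ct !tensmx_mul mulmx1 unit_mxM eqxx.
  by rewrite -EK_quad.
have -> : S *m (T *m ((E k0 *m K) *t P0) *m T^t*) *m S^t*
    = (S *m T *m (E k0 *t P0)) *m (K *t 1%:M) *m (S *m T *m (E k0 *t P0))^t*.
  by rewrite KP !ctmxM !mulmxA.
rewrite SE -KP => KP_ge0 y.
pose e : 'cV[C]_#|{: L.-bseq 'I_N}| := delta_mx (enum_rank vac) 0.
have eE : e^t* *m P0 *m e = 1%:M.
  rewrite trmx_delta map_delta_mx !mul_delta_mx.
  by apply/matrixP=> i j; rewrite !mxE !ord1.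
have H i j : ((y *t e)^t* *m ((E k0 *m K) *t P0) *m (y *t e)) i j
    = (y^t* *m (E k0 *m K) *m y) 0 0.
  by rewrite ctmx_tens !tensmx_mul eE mxE [X in _ * X]mxE !ord1 eqxx mulr1.
by rewrite -(H (@ord0 0) (@ord0 0)); apply: (KP_ge0 (y *t e)).
Qed.

End GlobalConverse.

(** * Block projections and observability *)

Section BlockProjection.
Variables (C : numClosedFieldType) (N : nat) (p : 'I_N -> nat).
Local Notation r := (\sum_k p k)%N.

Definition block_proj (k : 'I_N) : 'M[C]_r :=
  diag_mx (\row_x (tagnat.sig1 x == k)%:R).

Lemma block_proj_orth k l :
  block_proj k *m block_proj l = if k == l then block_proj k else 0.
Proof.
rewrite mulmx_diag; apply/matrixP=> i j; rewrite !mxE -natrM mulnb.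
case: (eqVneq k l) => [<-|kl]; first by rewrite andbb !mxE.
rewrite mxE; case: eqP => [->|_] /=; last by rewrite mul0rn.
by rewrite (negPf kl) mul0rn.
Qed.

Lemma block_proj_sum : \sum_k block_proj k = 1%:M.
Proof.
apply/matrixP=> i j; rewrite summxE (bigD1 (tagnat.sig1 i)) //=.
rewrite [X in _ + X]big1.
  by rewrite !mxE eqxx addr0.
by move=> k ki; rewrite !mxE eq_sym (negPf ki) mul0rn.
Qed.

Lemma block_proj_herm k : (block_proj k)^t* = block_proj k.
Proof.
rewrite tr_diag_mx map_diag_mx; congr diag_mx.
by apply/rowP=> x; rewrite !mxE rmorph_nat.
Qed.

Lemma block_proj_comm (H : forall k, 'M[C]_(p k)) k :
  block_proj k *m (\mxdiag_j H j) = (\mxdiag_j H j) *m block_proj k.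
Proof.
apply/matrixP=> i j; rewrite mul_diag_mx mul_mx_diag !mxE mulrC.
case: (eqVneq (tagnat.sig1 i) (tagnat.sig1 j)) => [ij|_].
  by congr (_ * (_ == _)%:R).
by rewrite mxE !mul0r.
Qed.

(** Bridge between the blockwise [gr_AB] and [transfer] and their global counterparts. *)
Lemma submxrow_proj m n (M : 'M[C]_(m, r)) (M' : 'M[C]_(r, n)) k :
  submxrow M k *m submxcol M' k = M *m block_proj k *m M'.
Proof.
have ME : M *m block_proj k =
    \mxrow_j (if j == k then submxrow M j else 0).
  apply/mxrowP=> j; rewrite mxrowK; apply/matrixP=> i y.
  rewrite mxE mul_mx_diag !mxE tagnat.Rank1K.
  by case: ifP; rewrite ?mulr1 ?mulr0 !mxE.
rewrite ME -{2}(submxcolK M') mul_mxrow_mxcol (bigD1 k) //= eqxx.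
rewrite [X in _ + X]big1 ?addr0 //.
by move=> j /negPf->; rewrite mul0mx.
Qed.

End BlockProjection.

Section NodeTransfer.
Variables (C : numClosedFieldType) (N q : nat) (a : GRnode C N q).
Local Notation E := (block_proj C (gr_dim a)).
Local Notation AB := (words_AB E (gr_A a) (gr_B a)).

Lemma gr_AB_global j w : gr_AB a j w = submxcol (AB w) j.
Proof.
elim: w j => //= k w IHw j.
by rewrite IHw submxblockEv submxrow_proj !submxcol_mul.
Qed.

Lemma transfer_global :
  global_transfer E (gr_A a) (gr_B a) (gr_C a) (gr_D a) =1 transfer a.
Proof. by case=> //= j w; rewrite gr_AB_global submxrow_proj. Qed.

End NodeTransfer.

(** * Observable reduction of a realization *)

Lemma bounded_stationary (u : nat -> nat) M :
  (forall L, u L <= M)%N -> exists L, (u L.+1 <= u L)%N.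
Proof.
move=> uM; case: (boolP [exists L : 'I_M.+1, (u L.+1 <= u L)%N]).
  by case/existsP=> L ?; exists L.
move/existsPn => u_lt; suff : (M.+1 <= u M.+1)%N by rewrite ltnNge uM.
have: (M.+1 <= M.+1)%N by []; elim: {-2}M.+1 => // L IHL LM.
apply: leq_ltn_trans (IHL (ltnW LM)) _.
by rewrite ltnNge; apply: (u_lt (Ordinal LM)).
Qed.

Section Observability.
Variables (C : numClosedFieldType) (N q : nat) (a : GRnode C N q).
Local Notation E := (block_proj C (gr_dim a)).
Local Notation A := (gr_A a).
Local Notation B := (gr_B a).
Local Notation G := (gr_C a).
Local Notation O w := (G *m words_EA E A w).

(** Encoded as a row space: block k is observable by words of length at most L when this space is
    full. *)
Definition obs_space L k : 'M[C]_(gr_dim a k) :=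
  (\sum_(w : L.-bseq 'I_N) <<submxrow (O w) k>>)%MS.

Lemma words_EA_rcons w j :
  words_EA E A (rcons w j) = words_EA E A w *m E j *m A.
Proof.
elim: w => [|i w IHw] /=; first by rewrite mulmx1 mul1mx.
by rewrite IHw !mulmxA.
Qed.

Lemma obs_mem L k (w : seq 'I_N) :
  (size w <= L)%N -> (submxrow (O w) k <= obs_space L k)%MS.
Proof.
move=> wL; apply: (sumsmx_sup (Bseq wL)) => //=.
by rewrite genmxE.
Qed.

Lemma obs_subP L k m (M : 'M[C]_(gr_dim a k, m)) n (M' : 'M[C]_(n, m)) :
  (forall w, (size w <= L)%N -> (submxrow (O w) k *m M <= M')%MS) ->
  (obs_space L k *m M <= M')%MS.
Proof.
move=> H; rewrite sumsmxMr_gen; apply/sumsmx_subP => w _.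
rewrite genmxE (eqmxMr _ (genmxE _)); apply: H; exact: size_bseq.
Qed.

Lemma obs_mono L k : (obs_space L k <= obs_space L.+1 k)%MS.
Proof.
rewrite -[obs_space L k]mulmx1; apply: obs_subP => w wL.
by rewrite mulmx1 obs_mem // leqW.
Qed.

Lemma obs_step L j k :
  (obs_space L j *m submxblock A j k <= obs_space L.+1 k)%MS.
Proof.
apply: obs_subP => w wL.
have -> : submxrow (O w) j *m submxblock A j k = submxrow (O (rcons w j)) k.
  rewrite submxblockEv mul_submxrow submxrow_proj words_EA_rcons.
  by rewrite !mulmxA.
by apply: obs_mem; rewrite size_rcons.
Qed.

(** The ranks are summed over the blocks, so that one L serves all of them. *)
Lemma obs_stationary :
  exists L, forall k, (obs_space L.+1 k <= obs_space L k)%MS.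
Proof.
pose u L := (\sum_k \rank (obs_space L k))%N.
have [L] : exists L, (u L.+1 <= u L)%N.
  apply: (@bounded_stationary _ (\sum_k gr_dim a k)%N) => L.
  by apply: leq_sum => k _; apply: rank_leq_row.
move=> uL; exists L => k.
have := leqif_sum (fun k (_ : true) => mxrank_leqif_sup (obs_mono L k)).
move/leqifP; case: ifP => [/forallP/(_ k)//|_].
by rewrite ltnNge uL.
Qed.

Section Reduction.
Variable L : nat.
Hypothesis L_stat : forall k, (obs_space L.+1 k <= obs_space L k)%MS.

Local Notation rk k := (\rank (obs_space L k)).
Local Notation Q k := (row_base (obs_space L k)).
Local Notation S k := (pinvmx (Q k)).

Lemma obs_factor k m (M : 'M[C]_(m, gr_dim a k)) :
  (M <= obs_space L k)%MS -> M *m S k *m Q k = M.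
Proof. by move=> MO; rewrite mulmxKpV // eq_row_base. Qed.

(** The observable quotient in coordinates: the kernel of Q k is the part of block k invisible to
    words of length at most L, and S k is a right inverse of Q k. *)
Definition reduced_node : GRnode C N q :=
  @Build_GRnode C N q (fun k => rk k)
    (\mxblock_(j, k) (Q j *m submxblock A j k *m S k))
    (\mxcol_j (Q j *m submxcol B j))
    (\mxrow_k (submxrow G k *m S k))
    (gr_D a).

(** By stationarity the rows of Q_j A_jk stay in the observable space of block k, where S_k Q_k acts
    as the identity. *)
Lemma reduced_AB j w : gr_AB reduced_node j w = Q j *m gr_AB a j w.
Proof.
elim: w j => [|k w IHw] j /=; first by rewrite mxcolK.
rewrite IHw mxblockK mulmxA obs_factor; first by rewrite mulmxA.
apply: submx_trans (L_stat k); apply: submx_trans (obs_step L j k).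
by apply: submxMr; rewrite eq_row_base.
Qed.

Lemma reduced_transfer : transfer reduced_node =1 transfer a.
Proof.
case=> //= j w; rewrite reduced_AB mxrowK mulmxA obs_factor //.
by have := @obs_mem L j [::] isT; rewrite /= mulmx1.
Qed.

End Reduction.

(* An unobservable part could be divided out, giving a smaller realization. *)
Lemma minimal_observable f k : minimal_GR_realization a f ->
  exists L (Y : L.-bseq 'I_N -> 'M[C]_(\sum_k gr_dim a k, q)),
    \sum_(w : L.-bseq 'I_N) Y w *m G *m words_EA E A w *m E k = E k.
Proof.
move=> [af a_min]; have [L L_stat] := obs_stationary; exists L.
have bf : GR_realization (reduced_node L) f.
  by move=> w; rewrite reduced_transfer.
(* Minimality is tested against the reduced node, whose k-th dimension is the rank of this space. *)
have full : row_full (obs_space L k).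
  by rewrite -col_leq_rank; apply: (a_min _ bf k).
have /sub_sumsmxP[u uE] : (1%:M <= obs_space L k)%MS by rewrite sub1mx.
have gE (w : L.-bseq 'I_N) : <<submxrow (O w) k>>%MS =
    <<submxrow (O w) k>>%MS *m pinvmx (submxrow (O w) k) *m submxrow (O w) k.
  by rewrite mulmxKpV // genmxE.
pose I : 'M[C]_(\sum_k gr_dim a k) := 1%:M.
(* The u w write the identity of block k through generators of the row spaces, [pinvmx] rewrites
   these generators through the observability blocks, and [submxrow I k] embeds block k into the
   whole space. *)
exists (fun w => submxrow I k *m
  (u w *m (<<submxrow (O w) k>>%MS *m pinvmx (submxrow (O w) k)))).
transitivity (submxrow I k *m 1%:M *m submxcol I k); last first.
  by rewrite mulmx1 submxrow_proj mul1mx mulmx1.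
rewrite uE mulmx_sumr mulmx_suml; apply: eq_bigr => w _.
rewrite [in RHS]gE; set v := _ *m pinvmx _.
have OE : submxrow (O w) k *m submxcol I k = O w *m E k.
  by rewrite submxrow_proj mulmx1.
by rewrite -!mulmxA OE -!mulmxA.
Qed.

End Observability.

Theorem theorem6p3 (R : realType) (N q : nat) (J : 'M[R[i]]_q)
    (f : fps N 'M[R[i]]_q) (alpha : GRnode R[i] N q)
    (H : forall k : 'I_N, 'M[R[i]]_(gr_dim alpha k)) :
  signature_mx J ->
  rational f ->
  matrix_J_unitary J f ->
  minimal_GR_realization alpha f ->
  associated_hermitian J H ->
  matrix_J_inner J f <-> posdefmx (\mxdiag_k H k).
Proof.
move=> [Jh JJ] f_rat f_unit alpha_min [Hu Hh Uiso].
have [alpha_f _] := alpha_min.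
set Hd := \mxdiag_k H k in Hu Hh Uiso *; pose K := invmx Hd.
have Kh : K^t* = K by rewrite ctmx_inv Hh.
have UK := isometric_coisometric JJ Hu Uiso.
have fE : global_transfer (block_proj _ (gr_dim alpha)) (gr_A alpha)
    (gr_B alpha) (gr_C alpha) (gr_D alpha) =1 f.
  by move=> w; rewrite transfer_global alpha_f.
have EK k : block_proj _ (gr_dim alpha) k *m K
    = K *m block_proj _ (gr_dim alpha) k.
  rewrite -[RHS](mulmxK Hu) -!mulmxA (mulmxA _ Hd) block_proj_comm -/Hd.
  by rewrite !mulmxA mulVmx // mul1mx.
split=> [inner|Hpos]; last first.
  split=> // n W V; apply: (contractive_of_psd _ _ _ _ UK) => //.
  - exact: block_proj_orth.
  - exact: block_proj_sum.
  - exact: block_proj_herm.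
  have := psd_congr K (posdef_psd Hpos).
  by rewrite Kh mulVmx // mul1mx.
(* H is invertible, so semidefiniteness suffices; it follows from that of K = sum_k E_k K through H
   = H K H. *)
apply: psd_unit_posdef => //.
have K_ge0 : psdmx K.
  rewrite -[K]mul1mx -block_proj_sum mulmx_suml; apply: psd_sum => k.
  have [L [Y YE]] := minimal_observable k alpha_min.
  apply: (psd_of_inner _ _ _ EK UK fE YE f_rat inner).
  - exact: block_proj_orth.
  - exact: block_proj_sum.
  - exact: block_proj_herm.
by have := psd_congr Hd K_ge0; rewrite Hh mulmxV // mul1mx.
Qed.
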